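(* Let $r_0>0$, let $D=\{(x_1,x_2)\in\mathbb{R}^2:\sqrt{x_1^2+x_2^2}>r_0\}$, and let $q\in[2,\infty)$. Let $(v,p)$ be a smooth axisymmetric solution with no swirl of the stationary Navier-Stokes equations $$(v\cdot\nabla)v+\nabla p=\Delta v,\qquad \nabla\cdot v=0,\qquad v(x_1,x_2,x_3+2\pi)=v(x_1,x_2,x_3)$$ in $D\times S^1$, and assume that $$\int_{D\times S^1}|\nabla v(x)|^q\,dx<\infty .$$ Let $\omega^\theta=\partial_z v^r-\partial_r v^z$ and $\Omega=\omega^\theta/r$. Then $$\lim_{r\to\infty} r^{1+2/q-1/q^2}\sup_{z\in[-\pi,\pi]}|\Omega(r,z)|=0\quad\text{if } q>2,\qquad \lim_{r\to\infty} r^{3/2}\sup_{z\in[-\pi,\pi]}|\Omega(r,z)|=0\quad\text{if } q=2,$$ and $$\lim_{r\to\infty} r^{2/q-1/q^2}\sup_{z\in[-\pi,\pi]}|\omega^\theta(r,z)|=0\quad\text{if } q>2,\qquad \lim_{r\to\infty} r^{1/2}\sup_{z\in[-\pi,\pi]}|\omega^\theta(r,z)|=0\quad\text{if } q=2.$$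
   Context: $S^1=[-\pi,\pi]$ is the $x_3$-variable range; the velocity $v=(v_1,v_2,v_3)$ is $2\pi$-periodic in $x_3$, and integrals over $D\times S^1$ are over one period. $p$ is the scalar pressure. No boundary condition is imposed at $r=r_0$. Cylindrical coordinates: $r=\sqrt{x_1^2+x_2^2}$, $\theta=\tan^{-1}(x_2/x_1)$, $z=x_3$, with $e_r=(x_1/r,x_2/r,0)$, $e_\theta=(-x_2/r,x_1/r,0)$, $e_z=(0,0,1)$, and $v=v^re_r+v^\theta e_\theta+v^ze_z$. The solution $(v,p)$ is axisymmetric if $v^r,v^\theta,v^z,p$ are independent of $\theta$; it has no swirl if $v^\theta\equiv 0$. In the axisymmetric no-swirl case the vorticity is $\nabla\times v=\omega^\theta e_\theta$ with $\omega^\theta=\partial_z v^r-\partial_r v^z$. $|\nabla v|$ denotes the Euclidean norm of the matrix of first partial derivatives of $v$ in Cartesian coordinates. *)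

(* Defs.v *)
From HB Require Import structures.
From mathcomp Require Import all_boot all_order all_algebra.
From mathcomp Require Import all_classical all_reals all_analysis.

Set Implicit Arguments.
Unset Strict Implicit.
Unset Printing Implicit Defensive.

Import Order.TTheory GRing.Theory Num.Theory.
Import numFieldNormedType.Exports.

Local Open Scope classical_set_scope.
Local Open Scope ring_scope.

Section Space.
Context {R : realType}.

Definition vec3 (a b c : R) : 'rV[R]_3 := \row_(i < 3) [:: a; b; c]`_i.

Definition ebasis (i : 'I_3) : 'rV[R]_3 := delta_mx 0 i.

Definition x1 (x : 'rV[R]_3) : R := x 0 (@Ordinal 3 0 isT).
Definition x2 (x : 'rV[R]_3) : R := x 0 (@Ordinal 3 1 isT).

Definition dot (u w : 'rV[R]_3) : R := \sum_(i < 3) u 0 i * w 0 i.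

Definition partial (i : 'I_3) (f : 'rV[R]_3 -> R) : 'rV[R]_3 -> R :=
  fun x => 'D_(ebasis i) f x.

Definition partials (s : seq 'I_3) (f : 'rV[R]_3 -> R) : 'rV[R]_3 -> R :=
  foldr partial f s.

(* C^oo on an open set U, for functions whose values outside U are irrelevant *)
Definition smooth_on (U : set 'rV[R]_3) (f : 'rV[R]_3 -> R) : Prop :=
  forall (s : seq 'I_3) (x : 'rV[R]_3), U x ->
    {for x, continuous (partials s f)} /\
    (forall i : 'I_3, derivable (partials s f) x (ebasis i)).

Definition component (v : 'rV[R]_3 -> 'rV[R]_3) (i : 'I_3) : 'rV[R]_3 -> R :=
  fun x => v x 0 i.

Definition grad_norm (v : 'rV[R]_3 -> 'rV[R]_3) (x : 'rV[R]_3) : R :=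
  Num.sqrt (\sum_(i < 3) \sum_(j < 3) (partial j (component v i) x) ^+ 2).

Definition stationary_NS (U : set 'rV[R]_3)
    (v : 'rV[R]_3 -> 'rV[R]_3) (p : 'rV[R]_3 -> R) : Prop :=
  forall x, U x ->
    (forall i : 'I_3,
      (\sum_(j < 3) v x 0 j * partial j (component v i) x) + partial i p x
      = \sum_(j < 3) partial j (partial j (component v i)) x) /\
    \sum_(j < 3) partial j (component v j) x = 0.

Definition radius (x : 'rV[R]_3) : R := Num.sqrt (x1 x ^+ 2 + x2 x ^+ 2).

Definition cyl (r theta z : R) : 'rV[R]_3 :=
  vec3 (r * cos theta) (r * sin theta) z.

Definition e_r (x : 'rV[R]_3) : 'rV[R]_3 :=
  vec3 (x1 x / radius x) (x2 x / radius x) 0.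
Definition e_theta (x : 'rV[R]_3) : 'rV[R]_3 :=
  vec3 (- x2 x / radius x) (x1 x / radius x) 0.
Definition e_z : 'rV[R]_3 := vec3 0 0 1.

Definition v_r (v : 'rV[R]_3 -> 'rV[R]_3) (x : 'rV[R]_3) : R :=
  dot (v x) (e_r x).
Definition v_theta (v : 'rV[R]_3 -> 'rV[R]_3) (x : 'rV[R]_3) : R :=
  dot (v x) (e_theta x).
Definition v_z (v : 'rV[R]_3 -> 'rV[R]_3) (x : 'rV[R]_3) : R :=
  dot (v x) e_z.

(* The covering space {r > r0} x R of D x S^1: functions on D x S^1 are
   functions on this set that are 2pi-periodic in x3. *)
Definition exterior (r0 : R) : set 'rV[R]_3 := [set x | r0 < radius x].

Definition theta_independent (r0 : R) (f : 'rV[R]_3 -> R) : Prop :=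
  forall r theta theta' z : R, r0 < r -> f (cyl r theta z) = f (cyl r theta' z).

Definition axisymmetric (r0 : R)
    (v : 'rV[R]_3 -> 'rV[R]_3) (p : 'rV[R]_3 -> R) : Prop :=
  [/\ theta_independent r0 (v_r v), theta_independent r0 (v_theta v),
      theta_independent r0 (v_z v) & theta_independent r0 p].

Definition no_swirl (r0 : R) (v : 'rV[R]_3 -> 'rV[R]_3) : Prop :=
  forall x, exterior r0 x -> v_theta v x = 0.

Definition periodic_x3 (r0 : R) (v : 'rV[R]_3 -> 'rV[R]_3) : Prop :=
  forall x, exterior r0 x -> v (x + vec3 0 0 (2 * pi)) = v x.

(* v^r and v^z as functions of (r, z), read off at theta = 0: this is
   independent of the choice of theta when v is axisymmetric. *)
Definition omega_theta (v : 'rV[R]_3 -> 'rV[R]_3) (r z : R) : R :=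
  derive1 (fun z' : R => v_r v (cyl r 0 z')) z
  - derive1 (fun r' : R => v_z v (cyl r' 0 z)) r.

Definition Omega (v : 'rV[R]_3 -> 'rV[R]_3) (r z : R) : R :=
  omega_theta v r z / r.

(* D x [-pi, pi], one period, in the measurable space R * R * R *)
Definition period_cell (r0 : R) : set (R * R * R) :=
  [set t | r0 < Num.sqrt (t.1.1 ^+ 2 + t.1.2 ^+ 2) /\ - pi <= t.2 <= pi].

Definition grad_integral (r0 q : R) (v : 'rV[R]_3 -> 'rV[R]_3) : \bar R :=
  (\int[(@lebesgue_measure R \x @lebesgue_measure R)
         \x @lebesgue_measure R]_(t in period_cell r0)
     (grad_norm v (vec3 t.1.1 t.1.2 t.2) `^ q)%:E)%E.

Definition sup_z (f : R -> R -> R) (r : R) : \bar R :=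
  ereal_sup [set (`|f r z|)%:E | z in `[- pi, pi]].

Definition weighted_decay (a : R) (f : R -> R -> R) : Prop :=
  ((r `^ a)%:E * sup_z f r)%E @[r --> +oo%R] --> 0%E.

End Space.

(* Main.v *)
Require Import Defs.
From HB Require Import structures.
From mathcomp Require Import all_boot all_order all_algebra.
From mathcomp Require Import all_classical all_reals all_analysis.
From mathcomp Require Import measurable_realfun ring lra.

(** In a meridional half-plane an axisymmetric flow without swirl is described by
    its radial and axial velocities [u] and [w] as functions of [(r, z)], and the curl of
    the Navier-Stokes system becomes a scalar equation for [O = omega_theta / r],
    [u O_r + w O_z = O_rr + O_zz + (3 / r) O_r]
    ([vorticity_equation], [axisymmetric_planar_flow]).

    Let [h] be convex and integrate the equation of [h (O)] over a period in [z]. With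
    [A] the integral of [h (O)] and [B] that of [u h (O)], the flux
    [F = r A' + 2 A - r B] satisfies
    [F' = r * (integral of h'' (O) |grad O|^2) >= 0] and [(r^2 A)' = r F + r^2 B]
    ([is_derive_flux], [is_derive_r2mass]). The drift [B] is harmless: the mean of [u] over a
    period is a constant divided by [r], so that [|u|] is bounded on each circle by
    a function of [r] whose integrals over unit intervals are bounded
    ([u_le_speed]). This is used for two choices of [h].

    For [h (s) = (s^2 + d^2)^(q/2)] with a tiny [d], the hypothesis on [|grad v|^q] makes the
    integral of [A] over [[r, 2 r]] of order [r^(-q-1)] ([planar_energy_bound]). As [F] is
    monotone, a large value of [F] at one radius would persist on a unit interval and force
    [A] to be large there; hence [F = O(r^(-q))], and the increment of [F] over [[r, 2 r]]
    bounds the dissipation. So some radius in [[r, 2 r]] has both [A] and the dissipation of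
    order [r^(-q-2)], and a one-dimensional Sobolev inequality on the circle gives
    [sup |O|^q = O(r^(-q-2))] at that radius ([good_radius]).

    For [h (s) = ((s^2 - k)_+)^3], with [k] a common bound of [O^2] at two good radii,
    [A] and [F] vanish at both, hence [F] vanishes in between and so does [A]: this is the
    maximum principle ([vorticity_max_principle]), which carries the bound to all radii.

    The outcome is [O = O(r^(-1-2/q))] uniformly in [z] ([planar_decay]), and each of the
    weights in the theorem grows strictly more slowly than the inverse of this bound, or of
    the corresponding bound [r^(-2/q)] for [omega_theta]. *)

Set Implicit Arguments.
Unset Strict Implicit.
Unset Printing Implicit Defensive.

Import Order.TTheory GRing.Theory Num.Theory.
Import numFieldNormedType.Exports.

Local Open Scope classical_set_scope.
Local Open Scope ring_scope.

(** * Calculus in one variable *)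

Section Calculus.
Context {R : realType}.
Implicit Types (f g : R -> R) (a b x : R).

Lemma is_derive_cont f x d : is_derive x (1:R) f d -> {for x, continuous f}.
Proof.
by case=> fx _; apply: differentiable_continuous; apply/derivable1_diffP.
Qed.

(** Integrals in the radial variable are never formed: increments of
    primitives are compared through their derivatives. *)
Lemma derive_mono f g df dg a b : a <= b ->
  (forall x, a <= x <= b -> is_derive x (1:R) f (df x)) ->
  (forall x, a <= x <= b -> is_derive x (1:R) g (dg x)) ->
  (forall x, a <= x <= b -> df x <= dg x) ->
  f b - f a <= g b - g a.
Proof.
move=> ab Df Dg dfg.
have Dh x : a <= x <= b -> is_derive x (1:R) (g \- f) (dg x - df x).
  by move=> xab; apply: is_deriveB; [exact: Dg|exact: Df].
have [|c|c cab] := @MVT_segment R (g \- f) (fun x => dg x - df x) a b ab.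
- by move=> x; rewrite in_itv /= => /andP[/ltW ax /ltW xb]; apply: Dh; rewrite ax xb.
- apply/continuous_in_subspaceT => x; rewrite inE/= in_itv/= => xab.
  by apply: is_derive_cont (Dh _ xab).
move=> /= E.
have : 0 <= (dg c - df c) * (b - a).
  by rewrite mulr_ge0 // subr_ge0 // dfg //; move: cab; rewrite in_itv.
lra.
Qed.

Lemma derive_mvt f df a b : a < b ->
  (forall x, a <= x <= b -> is_derive x (1:R) f (df x)) ->
  exists2 c, a <= c <= b & f b - f a = df c * (b - a).
Proof.
move=> ab Df.
have [|c|c cab E] := @MVT_segment R f df a b (ltW ab).
- by move=> x; rewrite in_itv /= => /andP[/ltW ax /ltW xb]; apply: Df; rewrite ax xb.
- apply/continuous_in_subspaceT => x; rewrite inE/= in_itv/= => xab.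
  by apply: is_derive_cont (Df _ xab).
by exists c => //; move: cab; rewrite in_itv.
Qed.

(** The base point of the integral is [a + 1], inside the region where [f] is
    continuous, so that [f] is integrable on the closed intervals involved. *)
Lemma primitive_exists f a : (forall x, a < x -> {for x, continuous f}) ->
  exists F, forall x, a + 1 < x -> is_derive x (1:R) F (f x).
Proof.
move=> cf; exists (fun x => \int[@lebesgue_measure R]_(t in `[a+1, x]) f t)%R => x ax.
have a1x : a + 1 < x + 1 by lra.
have [||||D E] := @continuous_FTC1_closed R f (a+1) x (x+1).
- lra.
- apply: continuous_compact_integrable; first exact: segment_compact.
  apply/continuous_in_subspaceT => y; rewrite inE/= in_itv/= => /andP[ya _].
  apply: cf; lra.
- lra.
- apply: cf; lra.
apply: DeriveDef; first by [].
by rewrite -derive1E.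
Qed.

End Calculus.

(** * Integrals over a period *)

Section Period.
Context {R : realType}.

Definition zint (f : R -> R) : R := (\int[@lebesgue_measure R]_(z in `[- pi, pi]) f z)%R.

Implicit Types (f g : R -> R).

Lemma ltNpipi : - pi < pi :> R.
Proof. by have := @pi_gt0 R; lra. Qed.

Lemma zintegrable f : (forall z : R, {for z, continuous f}) ->
  (@lebesgue_measure R).-integrable `[- pi, pi] (EFin \o f).
Proof.
move=> cf; apply: continuous_compact_integrable; first exact: segment_compact.
by apply/continuous_in_subspaceT => y _; exact: cf.
Qed.

Lemma zintD f g : (forall z : R, {for z, continuous f}) -> (forall z : R, {for z, continuous g}) ->
  zint (fun z => f z + g z) = zint f + zint g.
Proof. by move=> cf cg; rewrite /zint RintegralD //; exact: zintegrable. Qed.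

Lemma zintB f g : (forall z : R, {for z, continuous f}) -> (forall z : R, {for z, continuous g}) ->
  zint (fun z => f z - g z) = zint f - zint g.
Proof. by move=> cf cg; rewrite /zint RintegralB //; exact: zintegrable. Qed.

Lemma zintZ c f : (forall z : R, {for z, continuous f}) ->
  zint (fun z => c * f z) = c * zint f.
Proof. by move=> cf; rewrite /zint RintegralZl //; exact: zintegrable. Qed.

Lemma zint_le f g : (forall z : R, {for z, continuous f}) -> (forall z : R, {for z, continuous g}) ->
  (forall z : R, - pi <= z <= pi -> f z <= g z) -> zint f <= zint g.
Proof.
by move=> cf cg fg; apply: le_Rintegral => //; exact: zintegrable.
Qed.

Lemma zint_ge0 f : (forall z : R, 0 <= f z) -> 0 <= zint f.
Proof. by move=> f0; exact: Rintegral_ge0. Qed.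

Lemma zint_cst c : zint (fun=> c) = 2 * pi * c.
Proof.
rewrite /zint Rintegral_cst //= lebesgue_measure_itv /= lte_fin ltNpipi /=.
lra.
Qed.

Lemma zint_FTC F f : (forall z : R, is_derive z (1:R) F (f z)) ->
  (forall z : R, {for z, continuous f}) -> zint f = F pi - F (- pi).
Proof.
move=> dF cf; rewrite /zint /Rintegral (continuous_FTC2 (F := F)) //.
- exact: ltNpipi.
- by apply/continuous_in_subspaceT => y _; exact: cf.
- split.
  + by move=> x _; case: (dF x).
  + by apply: cvg_at_right_filter; exact: is_derive_cont (dF _).
  + by apply: cvg_at_left_filter; exact: is_derive_cont (dF _).
- by move=> x _; rewrite derive1E; case: (dF x).
Qed.

Lemma zint_primitive f : (forall z : R, {for z, continuous f}) ->
  exists F, (forall z : R, - pi <= z <= pi -> is_derive z (1:R) F (f z)) /\ zint f = F pi - F (- pi).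
Proof.
move=> cf.
have [F dF] := @primitive_exists R f (- pi - 2) (fun x _ => cf x).
have dF' z : - pi <= z <= pi -> is_derive z (1:R) F (f z).
  by move=> /andP[z1 z2]; apply: dF; lra.
exists F; split=> //.
rewrite /zint /Rintegral (continuous_FTC2 (F := F)) //.
- exact: ltNpipi.
- by apply/continuous_in_subspaceT => y _; exact: cf.
- have P := @ltNpipi.
  split.
  + by move=> x; rewrite in_itv => /andP[/ltW h1 /ltW h2]; case: (dF' x) => //; apply/andP.
  + apply: cvg_at_right_filter; apply: is_derive_cont (dF' _ _); lra.
  + apply: cvg_at_left_filter; apply: is_derive_cont (dF' _ _); lra.
- move=> x; rewrite in_itv => /andP[/ltW h1 /ltW h2]; rewrite derive1E.
  by case: (dF' x) => //; apply/andP.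
Qed.

(** One-dimensional Sobolev bound: [f] takes its mean value somewhere, and
    departs from it by at most the integral of the bound [g] of its derivative. *)
Lemma zint_sup f f' g : (forall z : R, is_derive z (1:R) f (f' z)) ->
  (forall z : R, {for z, continuous g}) ->
  (forall z : R, - pi <= z <= pi -> `|f' z| <= g z) ->
  forall z : R, - pi <= z <= pi -> `|f z| <= (2 * pi)^-1 * `|zint f| + zint g.
Proof.
move=> df cg fg z zpi.
have P := @ltNpipi.
have cf y : {for y, continuous f} by exact: is_derive_cont (df y).
have [F [dF ->]] := zint_primitive cf.
have [G [dG ->]] := zint_primitive cg.
have [c cpi ->] := derive_mvt ltNpipi dF.
have -> : `|f c * (pi - - pi)| = (2 * pi) * `|f c|.
  by rewrite normrM [X in _ * X]ger0_norm; [lra|have := @pi_gt0 R; lra].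
rewrite mulKf; last by have := @pi_gt0 R; lra.
have osc x y : - pi <= x -> x <= y -> y <= pi -> `|f y - f x| <= G y - G x.
  move=> hx xy hy; rewrite ler_norml; apply/andP; split.
    have := @derive_mono R (fun x => - G x) f (fun x => - g x) f' x y xy.
    have -> : - G y - - G x = - (G y - G x) by lra.
    apply => t /andP[t1 t2].
    - by apply: is_deriveN; apply: dG; rewrite (le_trans hx t1) (le_trans t2 hy).
    - have := fg t; rewrite ler_norml => h.
      by have /andP[] : - g t <= f' t <= g t by apply: h; rewrite (le_trans hx t1) (le_trans t2 hy).
  apply: (@derive_mono R f G f' g x y xy) => t /andP[t1 t2].
  - by apply: dG; rewrite (le_trans hx t1) (le_trans t2 hy).
  - have := fg t; rewrite ler_norml => h.
    by have /andP[] : - g t <= f' t <= g t by apply: h; rewrite (le_trans hx t1) (le_trans t2 hy).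
have Gm x y : - pi <= x -> x <= y -> y <= pi -> G x <= G y.
  by move=> hx xy hy; have := osc x y hx xy hy; have := normr_ge0 (f y - f x); lra.
have : `|f z| <= `|f c| + `|f z - f c|.
  by rewrite (le_trans _ (ler_normD _ _))// addrC subrK.
move: zpi cpi => /andP[z1 z2] /andP[c1 c2].
have [cz|/ltW zc] := leP c z.
  have := osc c z c1 cz z2; have := Gm (- pi) c; have := Gm z pi.
  by rewrite !lexx z1 z2 c1 c2 => /(_ isT isT isT) ? /(_ isT isT isT) ?; lra.
rewrite distrC.
have := osc z c z1 zc c2; have := Gm (- pi) z; have := Gm c pi.
by rewrite !lexx z1 z2 c1 c2 => /(_ isT isT isT) ? /(_ isT isT isT) ?; lra.
Qed.

(** A primitive of [f] is nondecreasing with equal end values, hence constant. *)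
Lemma zint_eq0 f : (forall z : R, {for z, continuous f}) -> (forall z : R, 0 <= f z) ->
  zint f = 0 -> forall z : R, - pi < z < pi -> f z = 0.
Proof.
move=> cf f0; have [F [dF ->]] := zint_primitive cf => E z /andP[z1 z2].
have Fm x y : - pi <= x -> x <= y -> y <= pi -> F x <= F y.
  move=> hx xy hy.
  have := @derive_mono R (fun=> 0) F (fun=> 0) f x y xy.
  rewrite subr0 => h; rewrite -subr_ge0; apply: h => t /andP[t1 t2] //.
  - by apply: dF; rewrite (le_trans hx t1) (le_trans t2 hy).
have dFz : is_derive z (1:R) F (f z) by apply: dF; rewrite (ltW z1) (ltW z2).
have dFc : is_derive z (1:R) F 0.
  apply: (@near_eq_is_derive _ _ _ (cst (F (- pi))) F z 1 0).
  - near=> y.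
    have y1 : - pi < y by near: y; exact: lt_nbhsr.
    have y2 : y < pi by near: y; exact: lt_nbhsl.
    have := Fm (- pi) y (lexx _) (ltW y1) (ltW y2).
    have := Fm y pi (ltW y1) (ltW y2) (lexx _).
    by rewrite /cst; lra.
by case: dFz => _ <-; case: dFc.
Unshelve. all: by end_near. Qed.

End Period.

(** * Functions on the meridional half-plane *)

Section TwoVariables.
Context {R : realType}.
Implicit Types (f g : R -> R -> R) (r z : R).

(** Regularity in the half-plane [r > r0] is expressed by joint continuity of a
    function together with one-variable derivatives along the two axes. *)
Definition cont2 (r0 : R) f := forall r z, r0 < r ->
  {for (r, z), continuous (fun x : R * R => f x.1 x.2)}.

Lemma cont2D r0 f g : cont2 r0 f -> cont2 r0 g -> cont2 r0 (fun r z => f r z + g r z).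
Proof. by move=> cf cg r z rr; apply: continuousD; [exact: cf|exact: cg]. Qed.

Lemma cont2N r0 f : cont2 r0 f -> cont2 r0 (fun r z => - f r z).
Proof. by move=> cf r z rr; apply: continuousN; exact: cf. Qed.

Lemma cont2B r0 f g : cont2 r0 f -> cont2 r0 g ->
  cont2 r0 (fun r z => f r z - g r z).
Proof. by move=> cf cg; exact: cont2D cf (cont2N cg). Qed.

Lemma cont2M r0 f g : cont2 r0 f -> cont2 r0 g -> cont2 r0 (fun r z => f r z * g r z).
Proof. by move=> cf cg r z rr; apply: continuousM; [exact: cf|exact: cg]. Qed.

Lemma cont2_cst r0 c : cont2 r0 (fun _ _ => c).
Proof. by move=> r z _; exact: cst_continuous. Qed.

Lemma cont2_fst r0 : cont2 r0 (fun r _ => r).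
Proof. by move=> r z _; exact: cvg_fst. Qed.

Lemma cont2_comp r0 (h : R -> R) f : (forall t : R, {for t, continuous h}) ->
  cont2 r0 f -> cont2 r0 (fun r z => h (f r z)).
Proof.
move=> ch cf r z rr; apply: (@continuous_comp _ _ _ (fun x : R * R => f x.1 x.2) h).
- exact: cf.
- exact: ch.
Qed.

Lemma cont2_inv r0 : 0 <= r0 -> cont2 r0 (fun r _ => r^-1).
Proof.
move=> r00 r z rr; apply: continuousV; first by rewrite /=; lra.
exact: cvg_fst.
Qed.

Lemma cont2_slicez r0 f r : cont2 r0 f -> r0 < r -> forall z : R, {for z, continuous (f r)}.
Proof.
move=> cf rr z; apply: (@continuous_comp _ _ _ (fun z : R => (r, z)) (fun x : R * R => f x.1 x.2)).
- by apply: (@cvg_pair _ _ _ _ (nbhs r) (nbhs z)); [exact: cvg_cst|exact: cvg_id].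
- exact: cf.
Qed.

Lemma cont2_slicer r0 f z : cont2 r0 f -> forall r : R, r0 < r -> {for r, continuous (f^~ z)}.
Proof.
move=> cf r rr; apply: (@continuous_comp _ _ _ (fun r : R => (r, z)) (fun x : R * R => f x.1 x.2)).
- by apply: (@cvg_pair _ _ _ _ (nbhs r) (nbhs z)); [exact: cvg_id|exact: cvg_cst].
- exact: cf.
Qed.

Lemma cont2_bounded r0 f a b c d : cont2 r0 f -> r0 < a -> a <= b -> c <= d ->
  exists M : R, forall r z, a <= r <= b -> c <= z <= d -> `|f r z| <= M.
Proof.
move=> cf ra ab cd.
pose A := (`[a, b]%classic `*` `[c, d]%classic : set (R * R)).
have cA : compact A by apply: compact_setX; exact: segment_compact.
have A0 : A !=set0 by exists (a, c); split; rewrite /= in_itv /= !lexx ?ab ?cd.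
have cn : {within A, continuous (fun x : R * R => `|f x.1 x.2|)}.
  apply/continuous_in_subspaceT => -[r z]; rewrite inE/= => -[/= h1 h2].
  apply: (@continuous_comp _ _ _ (fun x : R * R => f x.1 x.2) (fun x => `|x|)).
    by apply: cf; move: h1; rewrite in_itv /= => /andP[h1 _]; exact: lt_le_trans h1.
  exact: norm_continuous.
have [m _ mP] := compact_EVT_max A0 cA cn.
exists `|f m.1 m.2| => r z rab zcd.
by apply: (mP (r, z)); rewrite inE; split; rewrite /= in_itv.
Qed.

(** The derivative [fr] is bounded on a compact neighbourhood of the slice, which
    provides the dominating constant. *)
Lemma zint_diff r0 f fr : cont2 r0 f -> cont2 r0 fr ->
  (forall r z, r0 < r -> is_derive r (1:R) (f^~ z) (fr r z)) ->
  forall r, r0 < r -> is_derive r (1:R) (fun r => zint (f r)) (zint (fr r)).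
Proof.
move=> cf cfr df r rr.
pose e := (r - r0) / 2.
have e0 : 0 < e by rewrite /e; lra.
have r0e : r0 < r - e by rewrite /e; lra.
have [M MP] := @cont2_bounded r0 fr (r - e) (r + e) (- pi) pi cfr r0e ltac:(lra) (ltW ltNpipi).
have M0 : 0 <= M.
  apply: le_trans (MP r 0 _ _); first exact: normr_ge0.
    by apply/andP; split; lra.
  by have := @pi_gt0 R => ?; apply/andP; split; lra.
have Ir : `](r - e), (r + e)[%classic r by rewrite /= in_itv/=; apply/andP; split; lra.
have E1 x z : r0 < x -> partial1of2 f x z = fr x z.
  by move=> rx; rewrite partial1of2E; case: (df x z rx).
have h1 : forall x, `](r - e), (r + e)[%classic x ->
    (@lebesgue_measure R).-integrable `[- pi, pi] (EFin \o f x).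
  move=> x /=; rewrite in_itv /= => /andP[h _]; apply: zintegrable => z.
  by apply: cont2_slicez; [exact: cf|lra].
have h2 : forall x y, `](r - e), (r + e)[%classic x -> `[- pi, pi]%classic y ->
    derivable (f ^~ y) x 1.
  move=> x y /=; rewrite in_itv /= => /andP[h _] _.
  by have [] : is_derive x (1:R) (f^~ y) (fr x y) by apply: df; lra.
have h4 : (@lebesgue_measure R).-integrable `[- pi, pi] (EFin \o cst M).
  by apply: zintegrable => z; exact: cst_continuous.
have h5 : forall x y, `](r - e), (r + e)[%classic x -> `[- pi, pi]%classic y ->
    `|partial1of2 f x y| <= cst M y.
  move=> x y /=; rewrite !in_itv /= => /andP[xa xb] yy.
  by rewrite E1; [apply: MP => //; apply/andP; split; lra|lra].
have h3 : forall y : R, 0 <= cst M y by [].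
apply: DeriveDef.
- exact: (@derivable_under_integral R _ _ (@lebesgue_measure R) f _ _ r _ _ Ir h1 h2 _ h3 h4 h5).
- rewrite -derive1E.
  rewrite (@differentiation_under_integral R _ _ (@lebesgue_measure R) f _ _ r _ _ Ir h1 h2 _ h3 h4 h5) //.
  by apply: eq_Rintegral => z _; rewrite E1.
Qed.

Lemma zint_cont r0 f : cont2 r0 f ->
  forall r : R, r0 < r -> {for r, continuous (fun r => zint (f r))}.
Proof.
move=> cf r rr.
pose e := (r - r0) / 2.
have e0 : 0 < e by rewrite /e; lra.
have r0e : r0 < r - e by rewrite /e; lra.
have [M MP] := @cont2_bounded r0 f (r - e) (r + e) (- pi) pi cf r0e ltac:(lra) (ltW ltNpipi).
have Ir : r \in `](r - e), (r + e)[%classic by rewrite inE /= in_itv/=; apply/andP; split; lra.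
apply: (@continuity_under_integral R _ _ (@lebesgue_measure R) f _ _ (r - e) (r + e) _ _ (cst M)) => //.
- move=> x /=; rewrite in_itv /= => /andP[h _]; apply: zintegrable => z.
  by apply: cont2_slicez; [exact: cf|lra].
- apply: aeW => y _ x; rewrite inE /= in_itv /= => /andP[h _].
  by apply: cont2_slicer; [exact: cf|lra].
- by apply: zintegrable => z; exact: cst_continuous.
- move=> x; rewrite /= in_itv /= => /andP[h h']; apply: aeW => y; rewrite /= in_itv /= => yy.
  by apply: MP => //; apply/andP; split; lra.
Qed.

(** Schwarz's theorem: the mean value theorem, applied in either order, turns
    one and the same double difference over a square of side [h] into a value of
    [frz] and into a value of [fzr] near the corner. *)
Lemma mixed_partials r0 f fr fz frz fzr :
  (forall r z, r0 < r -> is_derive r (1:R) (f^~ z) (fr r z)) ->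
  (forall r z, r0 < r -> is_derive z (1:R) (f r) (fz r z)) ->
  (forall r z, r0 < r -> is_derive z (1:R) (fr r) (frz r z)) ->
  (forall r z, r0 < r -> is_derive r (1:R) (fz^~ z) (fzr r z)) ->
  cont2 r0 frz -> cont2 r0 fzr ->
  forall r z, r0 < r -> frz r z = fzr r z.
Proof.
move=> dr dz drz dzr crz czr r z rr.
apply/eqP; rewrite -subr_eq0 -normr_le0; apply/ler_addgt0Pl => eps eps0; rewrite addr0.
have e2 : 0 < eps / 2 by lra.
have := crz r z rr; move=> /cvgrPdist_lt /(_ _ e2) /nbhs_ballP[d1 /= d10 h1].
have := czr r z rr; move=> /cvgrPdist_lt /(_ _ e2) /nbhs_ballP[d2 /= d20 h2].
pose h := Num.min d1 d2 / 2.
have h0 : 0 < h by rewrite /h divr_gt0 // lt_min d10.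
have hd1 : h < d1.
  by have : Num.min d1 d2 <= d1 by [rewrite ge_min lexx]; rewrite /h in h0 *; lra.
have hd2 : h < d2.
  by have : Num.min d1 d2 <= d2 by [rewrite ge_min lexx orbT]; rewrite /h in h0 *; lra.
have rh : r < r + h by lra.
have zh : z < z + h by lra.
have [c /andP[c1 c2] Ec] := @derive_mvt R (fun x => f x (z + h) - f x z)
  (fun x => fr x (z + h) - fr x z) r (r + h) rh
  (fun x hx => is_deriveB (dr x (z + h) ltac:(lra)) (dr x z ltac:(lra))).
have [c' /andP[c'1 c'2] Ec'] := derive_mvt zh (fun y _ => drz c y ltac:(lra)).
have [d /andP[d1' d2'] Ed] := @derive_mvt R (fun y => f (r + h) y - f r y)
  (fun y => fz (r + h) y - fz r y) z (z + h) zh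
  (fun y hy => is_deriveB (dz (r + h) y ltac:(lra)) (dz r y ltac:(lra))).
have [d' /andP[d'1 d'2] Ed'] := derive_mvt rh (fun x hx => dzr x d ltac:(lra)).
have E : frz c c' = fzr d' d.
  have hh : h * h != 0 by rewrite mulf_neq0 //; lra.
  by apply: (mulIf hh); rewrite /= in Ec Ed Ec' Ed' *; rewrite Ec' in Ec; rewrite Ed' in Ed; lra.
have B1 : `|frz r z - frz c c'| < eps / 2.
  apply: (h1 (c, c')); split; rewrite /= /ball /= ltr_distlC; apply/andP; split; lra.
have B2 : `|fzr r z - fzr d' d| < eps / 2.
  apply: (h2 (d', d)); split; rewrite /= /ball /= ltr_distlC; apply/andP; split; lra.
rewrite E in B1.
have -> : frz r z - fzr r z = (frz r z - fzr d' d) - (fzr r z - fzr d' d) by ring.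
by apply: (le_trans (ler_normB _ _)); lra.
Qed.

End TwoVariables.

(** * Convex test functions and differential inequalities *)

Section PointwiseDerivatives.
Context {R : realType}.
Implicit Types (f g : R -> R) (x a b : R).

Lemma der_eq f x a b : is_derive x (1:R) f a -> a = b -> is_derive x (1:R) f b.
Proof. by move=> h <-. Qed.

Lemma der_cst (c x : R) : is_derive x (1:R) (fun=> c) 0.
Proof. exact: is_derive_cst. Qed.

Lemma der_id x : is_derive x (1:R) (fun y : R => y) 1.
Proof. exact: is_derive_id. Qed.

Lemma derD f g x a b : is_derive x (1:R) f a -> is_derive x (1:R) g b ->
  is_derive x (1:R) (fun y => f y + g y) (a + b).
Proof. by move=> df dg; exact: is_deriveD. Qed.

Lemma derB f g x a b : is_derive x (1:R) f a -> is_derive x (1:R) g b ->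
  is_derive x (1:R) (fun y => f y - g y) (a - b).
Proof. by move=> df dg; exact: is_deriveB. Qed.

Lemma derN f x a : is_derive x (1:R) f a -> is_derive x (1:R) (fun y => - f y) (- a).
Proof. by move=> df; exact: is_deriveN. Qed.

Lemma derM f g x a b : is_derive x (1:R) f a -> is_derive x (1:R) g b ->
  is_derive x (1:R) (fun y => f y * g y) (a * g x + f x * b).
Proof.
move=> df dg; apply: (der_eq (is_deriveM df dg)).
by rewrite addrC; congr (_ + _); rewrite /GRing.scale /= mulrC.
Qed.

Lemma derZ c f x a : is_derive x (1:R) f a -> is_derive x (1:R) (fun y => c * f y) (c * a).
Proof. by move=> df; apply: (der_eq (derM (der_cst c x) df)); rewrite mul0r add0r. Qed.

Lemma der_comp f g x a b : is_derive (g x) (1:R) f a -> is_derive x (1:R) g b ->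
  is_derive x (1:R) (fun y => f (g y)) (a * b).
Proof. by move=> df dg; exact: is_derive1_comp. Qed.

Lemma derX2 f x a : is_derive x (1:R) f a -> is_derive x (1:R) (fun y => f y ^+ 2) (2 * f x * a).
Proof.
move=> df; have -> : (fun y => f y ^+ 2) = (fun y => f y * f y) by apply/funext => y; rewrite expr2.
by apply: (der_eq (derM df df)); ring.
Qed.

Lemma derV f x a : f x != 0 -> is_derive x (1:R) f a ->
  is_derive x (1:R) (fun y => (f y)^-1) (- a / (f x) ^+ 2).
Proof.
move=> fx df; apply: (der_eq (is_deriveV fx df)).
by rewrite /GRing.scale /= mulNr [RHS]mulNr mulrC.
Qed.

End PointwiseDerivatives.

Section Powers.
Context {R : realType}.
Implicit Types (s t p x : R).

Lemma powR_norm_continuous p : 0 < p -> forall t, {for t, continuous (fun x => `|x| `^ p)}.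
Proof.
move=> p0 t; have [->|t0] := eqVneq t 0; last first.
  apply: (@continuous_comp _ _ _ (fun x : R => `|x|) (fun x => x `^ p)).
    exact: norm_continuous.
  by apply: is_derive_cont (is_derive1_powR _ _); rewrite normr_gt0.
apply/cvgrPdist_lt => e e0; near=> x.
rewrite normr0 powR0 ?gt_eqF// sub0r normrN ger0_norm ?powR_ge0//.
have -> : e = (e `^ p^-1) `^ p by rewrite -powRrM mulVf ?gt_eqF // powRr1 // ltW.
apply: gt0_ltr_powR => //; rewrite ?nnegrE ?powR_ge0//.
near: x; have e1 : 0 < e `^ p^-1 by exact: powR_gt0.
have := @nbhs0_lt R R _ e1.
by [].
Unshelve. all: by end_near. Qed.

(** A smooth convex replacement of [|s| `^ (2 * p)], whose derivatives cause no
    trouble at [s = 0] when [p] is not an integer. *)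
Definition spow (d p : R) s := (s ^+ 2 + d ^+ 2) `^ p.
Definition spow' (d p : R) s := 2 * p * s * spow d (p - 1) s.
Definition spow'' (d p : R) s :=
  2 * p * spow d (p - 1) s + 2 * p * s * spow' d (p - 1) s.

Lemma spow_base (d s : R) : 0 < d -> 0 < s ^+ 2 + d ^+ 2.
Proof. by move=> d0; rewrite ltr_wpDl ?sqr_ge0 // exprn_gt0. Qed.

Lemma spow_ge0 d p s : 0 <= spow d p s.
Proof. exact: powR_ge0. Qed.

Lemma is_derive_spow d p s : 0 < d -> is_derive s (1:R) (spow d p) (spow' d p s).
Proof.
move=> d0; have b0 := spow_base s d0.
apply: (der_eq (@der_comp R (fun x => x `^ p) (fun s => s ^+ 2 + d ^+ 2) s _ _
  (is_derive1_powR _ b0) (derD (derX2 (der_id s)) (der_cst (d ^+ 2) s)))).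
rewrite /spow' /spow; ring.
Qed.

Lemma is_derive_spow' d p s : 0 < d -> is_derive s (1:R) (spow' d p) (spow'' d p s).
Proof.
move=> d0; apply: (der_eq (derM (derZ (2 * p) (der_id s)) (is_derive_spow (p - 1) s d0))).
rewrite /spow''; ring.
Qed.

Lemma spow_continuous d p s : 0 < d -> {for s, continuous (spow d p)}.
Proof. by move=> d0; exact: is_derive_cont (is_derive_spow p s d0). Qed.

Lemma spow''_continuous d p s : 0 < d -> {for s, continuous (spow'' d p)}.
Proof.
move=> d0.
have c1 : {for s, continuous (fun s => 2 * p * s)}.
  exact: is_derive_cont (derZ (2 * p) (der_id s)).
apply: continuousD.
- by apply: continuousM; [exact: cst_continuous|exact: spow_continuous].
- apply: continuousM => //.
  exact: is_derive_cont (is_derive_spow' (p - 1) s d0).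
Qed.

Lemma spow''_ge d p s : 1 <= p -> 2 * p * spow d (p - 1) s <= spow'' d p s.
Proof.
move=> p1; rewrite /spow'' lerDl /spow'.
have -> : 2 * p * s * (2 * (p - 1) * s * spow d (p - 1 - 1) s) =
  4 * p * (p - 1) * (s ^+ 2 * spow d (p - 1 - 1) s) by ring.
by rewrite mulr_ge0 //; [nra|rewrite mulr_ge0 ?sqr_ge0 ?spow_ge0].
Qed.

Lemma spow''_ge0 d p s : 1 <= p -> 0 <= spow'' d p s.
Proof.
move=> p1; apply: le_trans (spow''_ge d s p1).
by rewrite mulr_ge0 ?spow_ge0 //; lra.
Qed.

Lemma spowS d p s : 0 < d -> 0 < p -> spow d p s = (s ^+ 2 + d ^+ 2) * spow d (p - 1) s.
Proof. by move=> d0 p0; rewrite /spow mulr_powRB1 // ltW // spow_base. Qed.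

(** Young's inequality: with [b] the [z]-derivative of the vorticity, the left-hand
    side is the derivative entering [zint_sup], and the right-hand side consists of
    the two quantities controlled by the energy identity. *)
Lemma spow'_young d p s b : 0 < d -> 1 <= p ->
  `|spow' d p s * b| <= p * spow d p s + spow'' d p s * b ^+ 2.
Proof.
move=> d0 p1.
have h := spow''_ge d s p1; have k := spow_ge0 d (p - 1) s.
rewrite (spowS s d0 (lt_le_trans ltr01 p1)) /spow'; move: h k.
set X := spow d (p - 1) s; set Y := spow'' d p s => h k.
have b2 := sqr_ge0 b; have d2 := sqr_ge0 d; have s2 := sqr_ge0 s.
have h' : 2 * p * X * b ^+ 2 <= Y * b ^+ 2 by rewrite ler_wpM2r.
have pX : 0 <= p * X by rewrite mulr_ge0 //; lra.
have e1 : 0 <= p * X * (s - b) ^+ 2 by rewrite mulr_ge0 ?sqr_ge0.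
have e2 : 0 <= p * X * (s + b) ^+ 2 by rewrite mulr_ge0 ?sqr_ge0.
have e3 : 0 <= p * X * b ^+ 2 by rewrite mulr_ge0.
have e4 : 0 <= p * X * d ^+ 2 by rewrite mulr_ge0.
rewrite ler_norml; apply/andP; split; nra.
Qed.

Lemma spow_ge d p s : 0 <= p -> `|s| `^ (2 * p) <= spow d p s.
Proof.
move=> p0; rewrite powRrM powR_mulrn // real_normK ?num_real // /spow.
by rewrite ge0_ler_powR ?nnegrE ?addr_ge0 ?sqr_ge0 // lerDl sqr_ge0.
Qed.

Lemma powR_addr_le p x t : 0 <= p -> 0 <= x -> 0 <= t ->
  (x + t) `^ p <= 2 `^ p * (x `^ p + t `^ p).
Proof.
move=> p0 x0 t0.
have [xt|/ltW tx] := leP x t.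
  apply: (@le_trans _ _ ((2 * t) `^ p)).
    by rewrite ge0_ler_powR ?nnegrE //; lra.
  by rewrite powRM // ler_wpM2l ?powR_ge0 // lerDr powR_ge0.
apply: (@le_trans _ _ ((2 * x) `^ p)).
  by rewrite ge0_ler_powR ?nnegrE //; lra.
by rewrite powRM // ler_wpM2l ?powR_ge0 // lerDl powR_ge0.
Qed.

Definition pos s := Num.max s 0.

Lemma pos_ge0 s : 0 <= pos s.
Proof. by rewrite /pos le_max lexx orbT. Qed.

Lemma pos_continuous s : {for s, continuous pos}.
Proof. by apply: continuous_max; [exact: cvg_id|exact: cst_continuous]. Qed.

Lemma is_derive_pos2 s : is_derive s (1:R) (fun x => pos x ^+ 2) (2 * pos s).
Proof.
have [s0|s0|->] := ltgtP s 0.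
- rewrite /pos (max_idPr _) ?(ltW s0) // mulr0.
  apply: (@near_eq_is_derive _ R R (cst 0) _ _ _ _ _ (der_cst 0 s)).
  near=> y; have y0 : y < 0 by near: y; exact: lt_nbhsl.
  by rewrite /cst (max_idPr _) ?(ltW y0) // expr0n.
- rewrite {2}/pos (max_idPl _) ?(ltW s0) //.
  apply: (@near_eq_is_derive _ R R (fun y => y ^+ 2) _ _ _ _ _
    (der_eq (derX2 (der_id s)) (mulr1 _))).
  near=> y; have y0 : 0 < y by near: y; exact: lt_nbhsr.
  by rewrite /pos (max_idPl _) ?(ltW y0).
- rewrite {2}/pos maxxx mulr0.
  suff h : (fun h : R => h^-1 *: (pos (h *: 1 + 0) ^+ 2 - pos 0 ^+ 2)) @ 0^' --> (0 : R).
    apply: DeriveDef; first by apply/cvg_ex; exists 0.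
    by apply/cvg_lim.
  apply/cvgrPdist_lt => e e0; near=> h.
  have h0 : h != 0 by near: h; exact: nbhs_dnbhs_neq.
  have hlt : `|h| < e by near: h; apply: dnbhs0_lt.
  have p0 : pos 0 ^+ 2 = 0 :> R by rewrite /pos maxxx expr0n.
  have -> : 0 - h^-1 *: (pos (h *: 1 + 0) ^+ 2 - pos 0 ^+ 2) = - (h^-1 * pos h ^+ 2).
    by rewrite p0 sub0r subr0 addr0; congr (- (_ * pos _ ^+ 2)); exact: mulr1.
  rewrite normrN /pos; have [hle|hgt] := leP h 0.
    by rewrite expr2 mul0r mulr0 normr0.
  by rewrite expr2 mulKf.
Unshelve. all: by end_near. Qed.

(** The cube of the positive part of [s ^+ 2 - k], written as a product so that
    [is_derive_pos2] is the only derivative of a positive part to be computed. It is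
    convex, twice continuously differentiable, and vanishes exactly where
    [s ^+ 2 <= k]. *)
Definition trunc3 (k s : R) := (s ^+ 2 - k) * pos (s ^+ 2 - k) ^+ 2.
Definition trunc3' (k s : R) := 6 * s * pos (s ^+ 2 - k) ^+ 2.
Definition trunc3'' (k s : R) := 6 * pos (s ^+ 2 - k) ^+ 2 + 24 * s ^+ 2 * pos (s ^+ 2 - k).

Lemma pos_sqr t : t * pos t = pos t ^+ 2.
Proof. by rewrite /pos; case: (leP t 0) => h; rewrite ?mulr0 ?expr0n //= expr2. Qed.

Lemma is_derive_trunc3 k s : is_derive s (1:R) (trunc3 k) (trunc3' k s).
Proof.
have d1 : is_derive s (1:R) (fun s => s ^+ 2 - k) (2 * s).
  by apply: (der_eq (derB (derX2 (der_id s)) (der_cst k s))); ring.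
apply: (der_eq (derM d1 (der_comp (is_derive_pos2 _) d1))).
rewrite /trunc3' [X in _ + X]mulrA [X in _ + X * _]mulrCA pos_sqr; ring.
Qed.

Lemma is_derive_trunc3' k s : is_derive s (1:R) (trunc3' k) (trunc3'' k s).
Proof.
have d1 : is_derive s (1:R) (fun s => s ^+ 2 - k) (2 * s).
  by apply: (der_eq (derB (derX2 (der_id s)) (der_cst k s))); ring.
apply: (der_eq (derM (derZ 6 (der_id s)) (der_comp (is_derive_pos2 _) d1))).
rewrite /trunc3''; ring.
Qed.

Lemma trunc3''_continuous k s : {for s, continuous (trunc3'' k)}.
Proof.
have d1 : is_derive s (1:R) (fun s => s ^+ 2 - k) (2 * s).
  by apply: (der_eq (derB (derX2 (der_id s)) (der_cst k s))); ring.
apply: continuousD; apply: continuousM.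
- exact: cst_continuous.
- exact: is_derive_cont (der_comp (is_derive_pos2 _) d1).
- exact: is_derive_cont (derZ 24 (derX2 (der_id s))).
- apply: (@continuous_comp _ _ _ (fun s => s ^+ 2 - k) pos).
    exact: is_derive_cont d1.
  exact: pos_continuous.
Qed.

Lemma trunc3_ge0 k s : 0 <= trunc3 k s.
Proof.
rewrite /trunc3; set t := s ^+ 2 - k.
by rewrite (expr2 (pos t)) mulrA pos_sqr mulr_ge0 ?sqr_ge0 ?pos_ge0.
Qed.

Lemma trunc3''_ge0 k s : 0 <= trunc3'' k s.
Proof.
have h := pos_ge0 (s ^+ 2 - k); rewrite /trunc3''; apply: addr_ge0.
  by rewrite mulr_ge0 ?sqr_ge0.
by rewrite mulr_ge0 // mulr_ge0 ?sqr_ge0.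
Qed.

Lemma trunc3_eq0 k s : trunc3 k s = 0 -> s ^+ 2 <= k.
Proof.
rewrite leNgt => E; apply/negP => ks; move: E; rewrite /trunc3.
have h : 0 < s ^+ 2 - k by rewrite subr_gt0.
by rewrite /pos (max_idPl (ltW h)) => /eqP; rewrite mulf_eq0 expf_eq0 /= orbb gt_eqF.
Qed.

Lemma trunc3_le k s : s ^+ 2 <= k -> trunc3 k s = 0 /\ trunc3' k s = 0.
Proof.
by move=> h; rewrite /trunc3 /trunc3' /pos (max_idPr _) ?subr_le0 // expr0n !mulr0.
Qed.

End Powers.

Section ODE.
Context {R : realType}.
Implicit Types (P dP K V N : R -> R) (a b x m kappa : R).

Lemma is_derive_expN K V a x : is_derive x (1:R) K (V x) ->
  is_derive x (1:R) (fun x => expR (K x - a)) (V x * expR (K x - a)).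
Proof.
move=> dK; apply: (der_eq (der_comp (is_derive_expR _) (derB dK (der_cst a x)))).
by rewrite subr0 mulrC.
Qed.

(** The integrating factor [expR (K - K a)] turns the differential inequality into
    linear growth of [P] at rate [m], hence quadratic growth of its primitive [N];
    the factor [expR kappa] is what the term in [V] costs. Read backwards, the
    increment of [N] bounds [m]. *)
Lemma growth_forward P dP K V N a b m kappa : a <= b -> 0 <= m ->
  (forall x, a <= x <= b -> is_derive x (1:R) P (dP x)) ->
  (forall x, a <= x <= b -> is_derive x (1:R) K (V x)) ->
  (forall x, a <= x <= b -> is_derive x (1:R) N (P x)) ->
  (forall x, a <= x <= b -> 0 <= P x) ->
  (forall x, a <= x <= b -> 0 <= V x) ->
  (forall x, a <= x <= b -> m - V x * P x <= dP x) ->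
  K b - K a <= kappa ->
  m * (b - a) ^+ 2 <= 2 * expR kappa * (N b - N a).
Proof.
move=> ab m0 dPP dK dN P0 V0 ineq hk.
have Km x y : a <= x -> x <= y -> y <= b -> K x <= K y.
  move=> hx xy hy; have := @derive_mono R (fun=> 0) K (fun=> 0) V x y xy.
  rewrite subr0 => h; rewrite -subr_ge0; apply: h => t /andP[t1 t2].
  - by apply: dK; apply/andP; split; lra.
  - by apply: V0; apply/andP; split; lra.
have S1 t : a <= t <= b -> m * (t - a) <= expR kappa * P t.
  move=> /andP[t1 t2].
  have h : m * t - m * a <= P t * expR (K t - K a) - P a * expR (K a - K a).
    have h1 x : a <= x <= t -> is_derive x (1:R) (fun x => m * x) (m * 1).
      by move=> _; exact: derZ (der_id x).
    have h2 x : a <= x <= t -> is_derive x (1:R) (fun x => P x * expR (K x - K a))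
        (dP x * expR (K x - K a) + P x * (V x * expR (K x - K a))).
      move=> /andP[x1 x2]; have xab : a <= x <= b by apply/andP; split; lra.
      by apply: derM; [exact: dPP|apply: is_derive_expN; exact: dK].
    apply: (derive_mono t1 h1 h2) => x /andP[x1 x2].
    have xab : a <= x <= b by apply/andP; split; lra.
    have e1 : 1 <= expR (K x - K a).
      by rewrite -expR0 ler_expR subr_ge0 Km //; lra.
    have := ineq x xab => hh.
    have -> : dP x * expR (K x - K a) + P x * (V x * expR (K x - K a)) =
      (dP x + V x * P x) * expR (K x - K a) by ring.
    have e0 : m <= dP x + V x * P x by lra.
    by rewrite mulr1; apply: (le_trans e0); rewrite ler_peMr //; lra.
  have e2 : P t * expR (K t - K a) <= P t * expR kappa.
    rewrite ler_wpM2l ?P0 ?t1 // ler_expR.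
    by have := Km t b t1 t2 (lexx _); lra.
  have e3 : 0 <= P a * expR (K a - K a) by rewrite mulr_ge0 ?expR_ge0 ?P0 ?lexx.
  lra.
have := @derive_mono R (fun x => m / 2 * (x - a) ^+ 2) (fun x => expR kappa * N x)
  (fun x => m / 2 * (2 * (x - a) * (1 - 0))) (fun x => expR kappa * P x) a b ab.
have h1 : forall x, a <= x <= b -> is_derive x (1:R) (fun x => m / 2 * (x - a) ^+ 2)
    (m / 2 * (2 * (x - a) * (1 - 0))).
  by move=> x _; exact: derZ (derX2 (derB (der_id x) (der_cst a x))).
have h2 : forall x, a <= x <= b -> is_derive x (1:R) (fun x => expR kappa * N x) (expR kappa * P x).
  by move=> x hx; apply: derZ; exact: dN.
have h3 : forall x, a <= x <= b -> m / 2 * (2 * (x - a) * (1 - 0)) <= expR kappa * P x.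
  by move=> x hx; have := S1 x hx; lra.
move=> /(_ h1 h2 h3); rewrite subrr expr0n /=; lra.
Qed.

(** The mirror image of [growth_forward] under [x |-> - x]. *)
Lemma growth_backward P dP K V N a b m kappa : a <= b -> 0 <= m ->
  (forall x, a <= x <= b -> is_derive x (1:R) P (dP x)) ->
  (forall x, a <= x <= b -> is_derive x (1:R) K (V x)) ->
  (forall x, a <= x <= b -> is_derive x (1:R) N (P x)) ->
  (forall x, a <= x <= b -> 0 <= P x) ->
  (forall x, a <= x <= b -> 0 <= V x) ->
  (forall x, a <= x <= b -> dP x <= - m + V x * P x) ->
  K b - K a <= kappa ->
  m * (b - a) ^+ 2 <= 2 * expR kappa * (N b - N a).
Proof.
move=> ab m0 dPP dK dN P0 V0 ineq hk.
have neg f (df : R -> R) (h : forall x, a <= x <= b -> is_derive x (1:R) f (df x)) :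
    forall x, - b <= x <= - a -> is_derive x (1:R) (fun x => - f (- x)) (df (- x)).
  move=> x /andP[x1 x2]; have nx : is_derive x (1:R) (fun y : R => - y) (- 1) by exact: derN (der_id x).
  apply: (der_eq (derN (@der_comp R f (fun y => - y) x _ _ (h (- x) _) nx))).
    by apply/andP; split; lra.
  by rewrite mulrN1 opprK.
have mem x : - b <= x <= - a -> a <= - x <= b by move=> /andP[? ?]; apply/andP; split; lra.
have h1 x : - b <= x <= - a -> is_derive x (1:R) (fun x => P (- x)) (- dP (- x)).
  by move=> hx; have := derN (neg _ _ dPP x hx); under eq_fun do rewrite opprK.
have h := growth_forward (_ : - b <= - a) m0 h1 (neg _ _ dK) (neg _ _ dN).
have -> : b - a = - a - - b by ring.
have -> : N b - N a = - N (- - a) - - N (- - b) by rewrite !opprK; ring.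
apply: h.
- by rewrite lerN2.
- by move=> x /mem; exact: P0.
- by move=> x /mem; exact: V0.
- by move=> x /mem /ineq; lra.
- by rewrite !opprK; lra.
Qed.

Lemma gronwall0 P dP K V a b : a <= b ->
  (forall x, a <= x <= b -> is_derive x (1:R) P (dP x)) ->
  (forall x, a <= x <= b -> is_derive x (1:R) K (V x)) ->
  (forall x, a <= x <= b -> dP x <= V x * P x) ->
  P a = 0 -> P b <= 0.
Proof.
move=> ab dPP dK ineq Pa.
have := @derive_mono R (fun x => P x * expR (- K x)) (fun=> 0)
  (fun x => dP x * expR (- K x) + P x * (expR (- K x) * (- V x))) (fun=> 0) a b ab.
have h1 : forall x, a <= x <= b -> is_derive x (1:R) (fun x => P x * expR (- K x))
    (dP x * expR (- K x) + P x * (expR (- K x) * (- V x))).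
  move=> x hx; apply: derM; first exact: dPP.
  exact: der_comp (is_derive_expR _) (derN (dK _ hx)).
have h2 : forall x, a <= x <= b ->
    dP x * expR (- K x) + P x * (expR (- K x) * (- V x)) <= 0.
  move=> x hx; have := ineq x hx; have := expR_gt0 (- K x); nra.
move=> /(_ h1 (fun x _ => der_cst 0 x) h2); rewrite Pa mul0r !subr0.
by rewrite pmulr_lle0 // expR_gt0.
Qed.

End ODE.

(** * Energy identities in the half-plane *)

Section PlanarFlow.
Context {R : realType}.

(** The flow in a meridional half-plane: [u] and [w] are the radial and axial
    velocities, [O] is the vorticity divided by [r], and the letters appended to a
    name indicate derivatives. Unlike the vorticity itself, [O] solves an equation
    without zero-order term, so that convex functions of [O] are subsolutions.
    Periodicity is recorded by equal values at [- pi] and [pi]. *)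
Record planar_flow (r0 : R) (u ur uz w wz O Or Oz Orr Ozz : R -> R -> R) : Prop := {
  pf_r0 : 0 <= r0;
  pf_cu : cont2 r0 u; pf_cur : cont2 r0 ur; pf_cuz : cont2 r0 uz;
  pf_cw : cont2 r0 w; pf_cwz : cont2 r0 wz;
  pf_cO : cont2 r0 O; pf_cOr : cont2 r0 Or; pf_cOz : cont2 r0 Oz;
  pf_cOrr : cont2 r0 Orr; pf_cOzz : cont2 r0 Ozz;
  pf_ur : forall r z, r0 < r -> is_derive r (1:R) (u^~ z) (ur r z);
  pf_uz : forall r z, r0 < r -> is_derive z (1:R) (u r) (uz r z);
  pf_wz : forall r z, r0 < r -> is_derive z (1:R) (w r) (wz r z);
  pf_Or : forall r z, r0 < r -> is_derive r (1:R) (O^~ z) (Or r z);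
  pf_Oz : forall r z, r0 < r -> is_derive z (1:R) (O r) (Oz r z);
  pf_Orr : forall r z, r0 < r -> is_derive r (1:R) (Or^~ z) (Orr r z);
  pf_Ozz : forall r z, r0 < r -> is_derive z (1:R) (Oz r) (Ozz r z);
  pf_w_per : forall r, r0 < r -> w r pi = w r (- pi);
  pf_O_per : forall r, r0 < r -> O r pi = O r (- pi);
  pf_Oz_per : forall r, r0 < r -> Oz r pi = Oz r (- pi);
  pf_div : forall r z, r0 < r -> ur r z + u r z / r + wz r z = 0;
  pf_vort : forall r z, r0 < r ->
    u r z * Or r z + w r z * Oz r z = Orr r z + Ozz r z + 3 / r * Or r z
}.

Context (r0 : R) (u ur uz w wz O Or Oz Orr Ozz : R -> R -> R).
Context (flow : planar_flow r0 u ur uz w wz O Or Oz Orr Ozz).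

Let r_gt0 r : r0 < r -> 0 < r.
Proof. by apply: le_lt_trans; exact: pf_r0 flow. Qed.

Section Convex.
Context (h h1 h2 : R -> R).
Context (dh : forall s : R, is_derive s (1:R) h (h1 s)).
Context (dh1 : forall s : R, is_derive s (1:R) h1 (h2 s)).
Context (ch2 : forall s : R, {for s, continuous h2}).
Context (h_ge0 : forall s, 0 <= h s).
Context (h2_ge0 : forall s, 0 <= h2 s).

Definition mass r := zint (fun z => h (O r z)).
Definition dissipation r := zint (fun z => h2 (O r z) * (Or r z ^+ 2 + Oz r z ^+ 2)).
Definition drift r := zint (fun z => u r z * h (O r z)).
(** The coefficient [2] is the one that makes the derivative of the flux exactly [r] times
    the dissipation; compare [fluxE] and [is_derive_flux]. *)
Definition flux_density r z :=
  r * (h1 (O r z) * Or r z) + 2 * h (O r z) - r * (u r z * h (O r z)).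
Definition flux r := zint (flux_density r).

Let ch s : {for s, continuous h}. Proof. exact: is_derive_cont (dh s). Qed.
Let ch1 s : {for s, continuous h1}. Proof. exact: is_derive_cont (dh1 s). Qed.

Let chO : cont2 r0 (fun r z => h (O r z)).
Proof. exact: cont2_comp ch (pf_cO flow). Qed.
Let ch1O : cont2 r0 (fun r z => h1 (O r z)).
Proof. exact: cont2_comp ch1 (pf_cO flow). Qed.
Let ch2O : cont2 r0 (fun r z => h2 (O r z)).
Proof. exact: cont2_comp ch2 (pf_cO flow). Qed.

Let dhr r z : r0 < r -> is_derive r (1:R) (fun r => h (O r z)) (h1 (O r z) * Or r z).
Proof. by move=> rr; exact: der_comp (dh _) (pf_Or flow z rr). Qed.
Let dhz r z : r0 < r -> is_derive z (1:R) (fun z => h (O r z)) (h1 (O r z) * Oz r z).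
Proof. by move=> rr; exact: der_comp (dh _) (pf_Oz flow z rr). Qed.

Lemma mass_ge0 r : 0 <= mass r.
Proof. by apply: zint_ge0 => z. Qed.

Lemma dissipation_ge0 r : 0 <= dissipation r.
Proof. by apply: zint_ge0 => z; rewrite mulr_ge0 // addr_ge0 ?sqr_ge0. Qed.

Lemma is_derive_mass r : r0 < r ->
  is_derive r (1:R) mass (zint (fun z => h1 (O r z) * Or r z)).
Proof.
move=> rr; apply: (@zint_diff R r0 (fun r z => h (O r z)) (fun r z => h1 (O r z) * Or r z)) => //.
exact: cont2M ch1O (pf_cOr flow).
Qed.

Lemma mass_continuous r : r0 < r -> {for r, continuous mass}.
Proof. by move=> rr; exact: is_derive_cont (is_derive_mass rr). Qed.

Lemma fluxE r : r0 < r ->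
  flux r = r * zint (fun z => h1 (O r z) * Or r z) + 2 * mass r - r * drift r.
Proof.
move=> rr; rewrite /flux /flux_density /mass /drift.
have c1 := cont2_slicez (cont2M ch1O (pf_cOr flow)) rr.
have c2 := cont2_slicez chO rr.
have c3 := cont2_slicez (cont2M (pf_cu flow) chO) rr.
have k (c : R) (f : R -> R) : (forall z : R, {for z, continuous f}) ->
   forall z : R, {for z, continuous (fun z => c * f z)}.
  by move=> cf z; apply: continuousM; [exact: cst_continuous|exact: cf].
rewrite zintB ?zintD ?zintZ //.
- exact: k.
- exact: k.
- by move=> z; apply: continuousD; exact: k.
- exact: k.
Qed.

(** By the vorticity equation and incompressibility, the [r]-derivative of the flux
    density is the dissipation density up to an exact [z]-derivative, the
    parenthesis subtracted here. *)
Let dens' r z := r * (h2 (O r z) * (Or r z ^+ 2 + Oz r z ^+ 2))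
  - (r * ((h2 (O r z) * Oz r z) * Oz r z + h1 (O r z) * Ozz r z)
     - r * (wz r z * h (O r z) + w r z * (h1 (O r z) * Oz r z))).

Let ddens r z : r0 < r -> is_derive r (1:R) (flux_density^~ z) (dens' r z).
Proof.
move=> rr; have r1 := r_gt0 rr.
have d1 := derM (der_id r) (derM (der_comp (dh1 _) (pf_Or flow z rr)) (pf_Orr flow z rr)).
have d2 := derM (der_id r) (derM (pf_ur flow z rr) (dhr z rr)).
apply: (der_eq (derB (derD d1 (derZ 2 (dhr z rr))) d2)).
rewrite /dens'.
have E1 := pf_div flow z rr; have E2 := pf_vort flow z rr.
have E1' : r * ur r z + u r z + r * wz r z = 0.
  transitivity (r * (ur r z + u r z / r + wz r z)); last by rewrite E1 mulr0.
  by field; rewrite gt_eqF.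
have E2' : r * Orr r z = r * (u r z * Or r z + w r z * Oz r z) - r * Ozz r z - 3 * Or r z.
  by rewrite E2; field; rewrite gt_eqF.
have -> : u r z = - (r * ur r z) - r * wz r z by lra.
move: E2'; have -> : u r z = - (r * ur r z) - r * wz r z by lra.
move: (h _) (h1 _) (h2 _) => H H1 H2 E2'.
have E3 : H1 * (r * Orr r z) = H1 * (r * ((- (r * ur r z) - r * wz r z) * Or r z +
    w r z * Oz r z) - r * Ozz r z - 3 * Or r z) by rewrite E2'.
lra.
Qed.

Let cdens' : cont2 r0 dens'.
Proof.
have cr := @cont2_fst R r0.
have c1 := cont2D (cont2M (pf_cOr flow) (pf_cOr flow)) (cont2M (pf_cOz flow) (pf_cOz flow)).
have c2 := cont2M cr (cont2M ch2O c1).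
have c3 := cont2D (cont2M (cont2M ch2O (pf_cOz flow)) (pf_cOz flow)) (cont2M ch1O (pf_cOzz flow)).
have c4 := cont2D (cont2M (pf_cwz flow) chO) (cont2M (pf_cw flow) (cont2M ch1O (pf_cOz flow))).
exact: cont2B c2 (cont2B (cont2M cr c3) (cont2M cr c4)).
Qed.

Let cdens : cont2 r0 flux_density.
Proof.
have cr := @cont2_fst R r0.
have c1 := cont2D (cont2M cr (cont2M ch1O (pf_cOr flow))) (cont2M (@cont2_cst R r0 2) chO).
exact: (cont2B c1 (cont2M cr (cont2M (pf_cu flow) chO))).
Qed.

(** The exact [z]-derivative in [ddens] integrates to zero over a period. *)
Lemma is_derive_flux r : r0 < r -> is_derive r (1:R) flux (r * dissipation r).
Proof.
move=> rr; apply: (der_eq (zint_diff cdens cdens' ddens rr)).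
rewrite /dens'.
pose G z := r * (h1 (O r z) * Oz r z) - r * (w r z * h (O r z)).
pose G' z := r * ((h2 (O r z) * Oz r z) * Oz r z + h1 (O r z) * Ozz r z)
     - r * (wz r z * h (O r z) + w r z * (h1 (O r z) * Oz r z)).
have dG z : is_derive z (1:R) G (G' z).
  exact: (derB (derZ r (derM (der_comp (dh1 _) (pf_Oz flow z rr)) (pf_Ozz flow z rr)))
    (derZ r (derM (pf_wz flow z rr) (dhz z rr)))).
have cr := @cont2_fst R r0.
have c1 := cont2D (cont2M (pf_cOr flow) (pf_cOr flow)) (cont2M (pf_cOz flow) (pf_cOz flow)).
have c2 := cont2M ch2O c1.
have c3 := cont2D (cont2M (cont2M ch2O (pf_cOz flow)) (pf_cOz flow)) (cont2M ch1O (pf_cOzz flow)).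
have c4 := cont2D (cont2M (pf_cwz flow) chO) (cont2M (pf_cw flow) (cont2M ch1O (pf_cOz flow))).
have cG' z : {for z, continuous G'}.
  exact: (cont2_slicez (cont2B (cont2M cr c3) (cont2M cr c4)) rr).
have cE := cont2_slicez c2 rr.
rewrite -/(G' _) zintB //; last exact: (cont2_slicez (cont2M cr c2) rr).
rewrite zintZ // (zint_FTC dG cG') /G (pf_O_per flow rr) (pf_Oz_per flow rr) (pf_w_per flow rr).
by rewrite subrr subr0.
Qed.

Lemma flux_mono r s : r0 < r -> r <= s -> flux r <= flux s.
Proof.
move=> rr rs; have h1' x : r <= x <= s -> is_derive x (1:R) flux (x * dissipation x).
  by move=> /andP[rx _]; apply: is_derive_flux; lra.
have := derive_mono rs (fun x _ => der_cst 0 x) h1'.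
rewrite subrr subr_ge0; apply => x /andP[rx _].
by rewrite mulr_ge0 ?dissipation_ge0 // ltW // r_gt0; lra.
Qed.

(** Since [r * mass' + 2 * mass] is [(r ^+ 2 * mass)' / r], a lower bound of the flux
    forces the mass to grow. *)
Lemma is_derive_r2mass r : r0 < r ->
  is_derive r (1:R) (fun r => r ^+ 2 * mass r) (r * flux r + r ^+ 2 * drift r).
Proof.
move=> rr; apply: (der_eq (derM (derX2 (der_id r)) (is_derive_mass rr))).
rewrite fluxE //; ring.
Qed.

Lemma drift_le r V : r0 < r -> (forall z, - pi <= z <= pi -> `|u r z| <= V) ->
  `|drift r| <= V * mass r.
Proof.
move=> rr uV; have c2 := cont2_slicez chO rr.
have c3 := cont2_slicez (cont2M (pf_cu flow) chO) rr.
have k (c : R) : forall z : R, {for z, continuous (fun z => c * h (O r z))}.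
  by move=> z; apply: continuousM; [exact: cst_continuous|exact: c2].
rewrite /drift /mass ler_norml -mulNr -!zintZ //; apply/andP; split; apply: zint_le => // z /uV.
- by rewrite ler_norml => /andP[uz1 _]; rewrite ler_wpM2r.
- by rewrite ler_norml => /andP[_ uz1]; rewrite ler_wpM2r.
Qed.

End Convex.

(** A pointwise bound for [|u|] on the circle of radius [r]: incompressibility makes
    the mean of [u] a constant over [r] ([mean_u]), and the oscillation of [u] around
    its mean is at most the integral of [|uz|]. Only the latter, which the energy
    controls, appears beside a bounded term. *)
Definition speed r :=
  (2 * pi)^-1 * (`|(r0 + 1) * zint (u (r0 + 1))| / r) + zint (fun z => `|uz r z|).

(** The derivative of [r * zint (u r)] is the period integral of [- r * wz]. *)
Lemma mean_u r : r0 + 1 <= r -> r * zint (u r) = (r0 + 1) * zint (u (r0 + 1)).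
Proof.
move=> rr.
have dm x : r0 < x -> is_derive x (1:R) (fun x => x * zint (u x)) 0.
  move=> rx; have x0 := r_gt0 rx.
  apply: (der_eq (derM (der_id x) (zint_diff (pf_cu flow) (pf_cur flow) (pf_ur flow) rx))).
  have cu := cont2_slicez (pf_cu flow) rx; have cur := cont2_slicez (pf_cur flow) rx.
  have cwz := cont2_slicez (pf_cwz flow) rx.
  have E : zint (wz x) = 0.
    rewrite (zint_FTC (fun z => pf_wz flow z rx)) // (pf_w_per flow rx) subrr //.
  rewrite mul1r -zintZ // -zintD //; last first.
    by move=> z; apply: continuousM; [exact: cst_continuous|exact: cur].
  transitivity (zint (fun z => (- x) * wz x z)); last by rewrite zintZ // E mulr0.
  congr zint; apply/funext => z.
  have Ed := pf_div flow z rx.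
  have -> : wz x z = - (ur x z + u x z / x) by lra.
  by field; rewrite gt_eqF.
have [le1 le2] : (fun x => x * zint (u x)) r <= (fun x => x * zint (u x)) (r0 + 1) /\
    (fun x => x * zint (u x)) (r0 + 1) <= (fun x => x * zint (u x)) r.
  have dm' x : r0 + 1 <= x <= r -> is_derive x (1:R) (fun x => x * zint (u x)) 0.
    by move=> /andP[rx _]; apply: dm; lra.
  have k1 := derive_mono rr dm' (fun x _ => der_cst 0 x) (fun x _ => lexx _).
  have k2 := derive_mono rr (fun x _ => der_cst 0 x) dm' (fun x _ => lexx _).
  by split; move: k1 k2; lra.
by apply/eqP; rewrite eq_le le1 le2.
Qed.

Let cuzn : cont2 r0 (fun r z => `|uz r z|).
Proof. by apply: cont2_comp (pf_cuz flow) => t; exact: norm_continuous. Qed.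

Lemma speed_ge0 r : r0 + 1 <= r -> 0 <= speed r.
Proof.
move=> rr; have r1 : 0 < r by apply: r_gt0; lra.
rewrite /speed addr_ge0 ?zint_ge0 // mulr_ge0 //.
  by rewrite invr_ge0 mulr_ge0 // ltW // pi_gt0.
by rewrite divr_ge0 // ltW.
Qed.

Lemma u_le_speed r z : r0 + 1 <= r -> - pi <= z <= pi -> `|u r z| <= speed r.
Proof.
move=> rr zpi; have rr0 : r0 < r by lra.
have r1 := r_gt0 rr0.
apply: (le_trans (zint_sup (fun z => pf_uz flow z rr0) (cont2_slicez cuzn rr0) _ zpi)) => //.
rewrite /speed lerD2r ler_wpM2l //.
  by rewrite invr_ge0 mulr_ge0 // ltW // pi_gt0.
rewrite -(mean_u rr) normrM (gtr0_norm r1) [r * _]mulrC mulfK ?gt_eqF //.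
Qed.

Lemma speed_continuous r : r0 < r -> {for r, continuous speed}.
Proof.
move=> rr; have r1 := r_gt0 rr.
apply: continuousD; last exact: (zint_cont cuzn).
apply: continuousM; first exact: cst_continuous.
apply: continuousM; first exact: cst_continuous.
by apply: continuousV; [rewrite gt_eqF|exact: cvg_id].
Qed.

End PlanarFlow.

(** * Decay of the vorticity in the half-plane *)

Section Decay.
Context {R : realType}.

Lemma zint_eq0_closed (f : R -> R) : (forall z : R, {for z, continuous f}) -> (forall z, 0 <= f z) ->
  zint f = 0 -> forall z, - pi <= z <= pi -> f z = 0.
Proof.
move=> cf f0 E z /andP[z1 z2].
have P := @ltNpipi R.
have F0 := zint_eq0 cf f0 E.
have [zpi|zpi] := eqVneq z pi.
  apply: (@cvg_unique R (@Rhausdorff R) (f @ pi^'-)).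
    by rewrite zpi; apply: cvg_at_left_filter; exact: cf.
  apply: (@cvg_trans _ ((fun=> 0) @ (pi:R)^'-)); last exact: cvg_cst.
  apply: near_eq_cvg; near=> y; apply/esym; apply: F0; apply/andP; split; near: y.
    exact: nbhs_left_gt.
  exact: nbhs_left_lt.
have [zpi'|zpi'] := eqVneq z (- pi).
  apply: (@cvg_unique R (@Rhausdorff R) (f @ (- pi)^'+)).
    by rewrite zpi'; apply: cvg_at_right_filter; exact: cf.
  apply: (@cvg_trans _ ((fun=> 0) @ (- pi:R)^'+)); last exact: cvg_cst.
  apply: near_eq_cvg; near=> y; apply/esym; apply: F0; apply/andP; split; near: y.
    exact: nbhs_right_gt.
  exact: nbhs_right_lt.
by apply: F0; rewrite !lt_neqAle z1 z2 zpi eq_sym zpi'.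
Unshelve. all: by end_near. Qed.

Context (r0 : R) (u ur uz w wz O Or Oz Orr Ozz : R -> R -> R).
Context (flow : planar_flow r0 u ur uz w wz O Or Oz Orr Ozz).

Let r_gt0 r : r0 < r -> 0 < r.
Proof. by apply: le_lt_trans; exact: pf_r0 flow. Qed.

(** Maximum principle without barrier functions: for [h = trunc3 k] mass and flux vanish
    at both ends. The flux is nondecreasing, hence zero in between, so that
    [r ^+ 2 * mass r] satisfies a linear differential inequality with zero initial value. *)
Lemma vorticity_max_principle (a b k : R) : r0 + 1 < a -> a <= b -> 
  (forall z, - pi <= z <= pi -> O a z ^+ 2 <= k) ->
  (forall z, - pi <= z <= pi -> O b z ^+ 2 <= k) ->
  forall r z : R, a <= r <= b -> - pi <= z <= pi -> O r z ^+ 2 <= k.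
Proof.
move=> ra ab Oa Ob r z /andP[ar rb] zpi.
pose A := mass O (trunc3 k).
have ra' : r0 < a by lra.
have dh := is_derive_trunc3 k; have dh1 := is_derive_trunc3' k.
have ch2 := @trunc3''_continuous R k.
have h0 := trunc3_ge0 k; have h20 := trunc3''_ge0 k.
have z0 (f : R -> R) : (forall z, - pi <= z <= pi -> f z = 0) -> zint f = 0.
  move=> f0; rewrite /zint (_ : \int[_]_(x in _) _ = \int[@lebesgue_measure R]_(x in `[- pi, pi]) 0)%R.
    by rewrite Rintegral_cst // mul0r.
  by apply: eq_Rintegral => x; rewrite inE /= in_itv /= => /f0.
have end0 x : (forall z, - pi <= z <= pi -> O x z ^+ 2 <= k) ->
    A x = 0 /\ flux u O Or (trunc3 k) (trunc3' k) x = 0.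
  move=> Ox; split; apply: z0 => y /Ox /trunc3_le [E1 E2] //.
  by rewrite /flux_density E1 E2 !(mulr0, mul0r) addr0 subr0.
have [Aa Fa] := end0 a Oa; have [Ab Fb] := end0 b Ob.
have F0 x : a <= x <= b -> flux u O Or (trunc3 k) (trunc3' k) x = 0.
  move=> /andP[ax xb]; apply/eqP; rewrite eq_le -{1}Fb -{1}Fa.
  by rewrite !(flux_mono flow dh dh1 ch2 h20) //; lra.
have [K dK] := primitive_exists (fun x rx => speed_continuous flow rx).
have dP x : a <= x <= r -> is_derive x (1:R) (fun x => x ^+ 2 * A x)
   (x ^+ 2 * drift u O (trunc3 k) x).
  move=> /andP[ax xr]; have rx : r0 < x by lra.
  apply: (der_eq (is_derive_r2mass flow dh dh1 rx)).
  by rewrite F0 ?mulr0 ?add0r //; apply/andP; split; lra.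
have dK' x : a <= x <= r -> is_derive x (1:R) K (speed r0 u uz x).
  by move=> /andP[ax _]; apply: dK; lra.
have ineq x : a <= x <= r -> x ^+ 2 * drift u O (trunc3 k) x <= speed r0 u uz x * (x ^+ 2 * A x).
  move=> /andP[ax xr]; rewrite mulrCA ler_wpM2l ?sqr_ge0 //.
  apply: (le_trans (ler_norm _)).
  by apply: (drift_le flow dh h0) => [|y]; [lra|apply: (u_le_speed flow); lra].
have := gronwall0 ar dP dK' ineq; rewrite Aa mulr0 => /(_ erefl).
have rr : 0 < r by apply: r_gt0; lra.
rewrite pmulr_rle0 ?exprn_gt0 // => A0; have Ar : A r = 0.
  by apply/eqP; rewrite eq_le A0 /= mass_ge0.
apply: trunc3_eq0.
apply: (@zint_eq0_closed (fun z => trunc3 k (O r z))) => //.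
apply: (@cont2_slicez R r0 (fun r z => trunc3 k (O r z))); last lra.
apply: cont2_comp; last exact: pf_cO flow.
by move=> t; exact: is_derive_cont (dh t).
Qed.

Context (p : R) (p_ge1 : 1 <= p) (e : R -> R -> R).
Context (ce : cont2 r0 e) (uz_e : forall r z, r0 < r -> uz r z ^+ 2 <= e r z).
Context (O_e : forall r z, r0 < r -> (r * O r z) ^+ 2 <= 2 * e r z).
Context (a C : R) (E : R -> R) (ha : r0 + 1 <= a) (ha1 : 1 <= a).
Context (dE : forall r, a < r -> is_derive r (1:R) E (zint (fun z => e r z `^ p))).
Context (hE : forall r, a < r -> r * (E (2 * r) - E r) <= C).

Let e_ge0 r z : r0 < r -> 0 <= e r z.
Proof. by move=> rr; apply: le_trans (uz_e z rr); exact: sqr_ge0. Qed.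

Let p_gt0 : 0 < p. Proof. by apply: lt_le_trans p_ge1. Qed.

Let cep r : r0 < r -> forall z : R, {for z, continuous (fun z => e r z `^ p)}.
Proof.
move=> rr; have c := cont2_slicez (cont2_comp (powR_norm_continuous p_gt0) ce) rr.
rewrite (_ : (fun z => e r z `^ p) = (fun z => `|e r z| `^ p)) //.
by apply/funext => z; rewrite ger0_norm // e_ge0.
Qed.

Let E_mono x y : a < x -> x <= y -> E x <= E y.
Proof.
have ha' := ha.
move=> ax xy; rewrite -subr_ge0 -(subrr (0:R)).
have h1 t : x <= t <= y -> is_derive t (1:R) E (zint (fun z => e t z `^ p)).
  by move=> /andP[xt _]; apply: dE; lra.
apply: (derive_mono xy (fun t _ => der_cst 0 t) h1) => t _.
by apply: zint_ge0 => z; exact: powR_ge0.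
Qed.

Let C_ge0 : 0 <= C.
Proof.
have a1 : a < a + 1 by lra.
have h1 := ha1; have a2 : 0 <= a + 1 by lra.
have a3 : a + 1 <= 2 * (a + 1) by lra.
by apply: le_trans (hE a1); rewrite mulr_ge0 // subr_ge0 E_mono.
Qed.

Section Annulus.
Context (r : R) (hr : 2 * a + 2 < r).

Let r2 : 4 < r. Proof. have h1 := ha1; have h2 := hr; lra. Qed.
Let rpos : 0 < r. Proof. have h := r2; lra. Qed.

(** The size [r `^ (- q)] of the ratio between the [q]-th powers of [O] and of the
    vorticity, for [q = 2 * p]. *)
Definition scale := (r ^- 2) `^ p.
Local Notation kappa := scale.

Let V_ge0 : 0 < r ^- 2. Proof. by rewrite invr_gt0 exprn_gt0. Qed.
Let V_le1 : r ^- 2 <= 1.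
Proof. have h := r2; by rewrite invf_le1 ?exprn_gt0 // expr_ge1 //; lra. Qed.

Lemma scale_gt0 : 0 < kappa. Proof. exact: powR_gt0. Qed.

Lemma scale_le : kappa <= r ^- 2.
Proof. by apply: ge1r_powR => //; rewrite V_ge0 V_le1. Qed.

(** The window from [r / 2] to [4 * r] is covered by three dyadic annuli. *)
Let E_osc x y : r / 2 <= x -> x <= y -> y <= 4 * r -> E y - E x <= 4 * C / r.
Proof.
have ha' := ha; have ha1' := ha1; have hr' := hr; have r2' := r2; have rpos' := rpos; have C0 := C_ge0.
move=> h1 h2 h3.
have i1 := hE (_ : a < r / 2); have i2 := hE (_ : a < r); have i3 := hE (_ : a < 2 * r).
have {}i1 := i1 ltac:(lra); have {}i2 := i2 ltac:(lra); have {}i3 := i3 ltac:(lra).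
have e1 : 2 * (r / 2) = r by field.
have e2 : 2 * (2 * r) = 4 * r by ring.
rewrite e1 in i1; rewrite e2 in i3.
have m1 : E (r / 2) <= E x by apply: E_mono; lra.
have m2 : E y <= E (4 * r) by apply: E_mono; lra.
by rewrite ler_pdivlMr //; nra.
Qed.

Let d := r ^- 2.
Let d_gt0 : 0 < d. Proof. exact: V_ge0. Qed.
Local Notation hh := (spow d p).
Local Notation hh1 := (spow' d p).
Local Notation hh2 := (spow'' d p).
Let dh s : is_derive s (1:R) hh (hh1 s). Proof. exact: is_derive_spow. Qed.
Let dh1 s : is_derive s (1:R) hh1 (hh2 s). Proof. exact: is_derive_spow'. Qed.
Let ch2 s : {for s, continuous hh2}. Proof. exact: spow''_continuous. Qed.
Let h_ge0 s : 0 <= hh s. Proof. exact: spow_ge0. Qed.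
Let h2_ge0 s : 0 <= hh2 s. Proof. exact: spow''_ge0. Qed.

Definition c_mass := 2 `^ p * (8 `^ p + 2 * pi).

Let c_mass_ge0 : 0 <= c_mass.
Proof. by rewrite mulr_ge0 ?powR_ge0 // addr_ge0 ?powR_ge0 // mulr_ge0 // ltW // pi_gt0. Qed.

(** With [d = r ^- 2] the regularization contributes only [kappa * kappa], which is
    at most [kappa * r ^- 2]. *)
Let mass_le x : r / 2 <= x -> 
  mass O hh x <= kappa * c_mass * (zint (fun z => e x z `^ p) + r ^- 2).
Proof.
have ha' := ha; have ha1' := ha1; have hr' := hr; have r2' := r2; have rpos' := rpos; have C0 := C_ge0.
move=> rx; have rx0 : r0 < x by lra.
have cOx := pf_cO flow.
have c1 : forall z : R, {for z, continuous (fun z => hh (O x z))}.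
  apply: (@cont2_slicez R r0 (fun r z => hh (O r z))) => //.
  by apply: cont2_comp cOx => t; exact: is_derive_cont (dh t).
have c2 := cep rx0.
have c3 : forall z : R, {for z, continuous (fun z => kappa * (2 `^ p * 8 `^ p) * e x z `^ p)}.
  by move=> z; apply: continuousM; [exact: cst_continuous|exact: c2].
have c4 : forall z : R, {for z, continuous (fun z : R => kappa * (2 `^ p * r ^- 2))}.
  by move=> z; exact: cst_continuous.
apply: (@le_trans _ _ (zint (fun z => kappa * (2 `^ p * 8 `^ p) * e x z `^ p +
    kappa * (2 `^ p * r ^- 2)))).
  apply: zint_le => // [z|z _].
    by apply: continuousD; [exact: c3|exact: c4].
  have Oe := O_e z rx0.
  have e0 := e_ge0 z rx0.
  have O2 : O x z ^+ 2 <= 8 * e x z * r ^- 2.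
    rewrite ler_pdivlMr ?exprn_gt0 //.
    have x2 : r ^+ 2 <= 4 * x ^+ 2 by nra.
    have : O x z ^+ 2 * r ^+ 2 <= O x z ^+ 2 * (4 * x ^+ 2) by rewrite ler_wpM2l ?sqr_ge0.
    move: Oe; rewrite exprMn; lra.
  apply: (@le_trans _ _ ((8 * e x z * r ^- 2 + d ^+ 2) `^ p)).
    rewrite /spow ge0_ler_powR ?nnegrE ?addr_ge0 ?sqr_ge0 ?lerD2r // ?(ltW p_gt0) //.
    by rewrite mulr_ge0 ?mulr_ge0 // ltW.
  apply: (le_trans (powR_addr_le _ _ _)).
  - exact: ltW.
  - by rewrite mulr_ge0 ?mulr_ge0 // ltW.
  - exact: sqr_ge0.
  rewrite expr2 /d !powRM ?(ltW V_ge0) ?mulr_ge0 // -/scale.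
  have k1 := scale_le; have k0 := scale_gt0.
  have k2 : kappa * kappa <= kappa * r ^- 2 by rewrite ler_wpM2l // ltW.
  have t0 : 0 <= 2 `^ p :> R by exact: powR_ge0.
  have : 2 `^ p * (kappa * kappa) <= 2 `^ p * (kappa * r ^- 2) by rewrite ler_wpM2l.
  lra.
rewrite zintD // zintZ // zint_cst /c_mass.
have G0 : 0 <= zint (fun z => e x z `^ p) by apply: zint_ge0 => z; exact: powR_ge0.
move: (zint _) G0 => G G0.
have k0 := ltW scale_gt0; have t0 : 0 <= 2 `^ p :> R by exact: powR_ge0.
have t8 : 0 <= 8 `^ p :> R by exact: powR_ge0.
have pp := @pi_gt0 R.
have kt : 0 <= kappa * 2 `^ p by rewrite mulr_ge0.
have f1 : 0 <= kappa * 2 `^ p * (8 `^ p * r ^- 2) by rewrite mulr_ge0 // mulr_ge0 // ltW.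
have f2 : 0 <= kappa * 2 `^ p * (2 * pi * G) by rewrite mulr_ge0 // mulr_ge0 // mulr_ge0 // ltW.
lra.
Qed.

Definition c_speed := (2 * pi)^-1 * `|(r0 + 1) * zint (u (r0 + 1))| + 2 * pi + 4 * C.

(** Uses [|t| <= 1 + |t| `^ (2 * p)] under the integral. *)
Let speed_le x : r / 2 <= x ->
  speed r0 u uz x <= (2 * pi)^-1 * `|(r0 + 1) * zint (u (r0 + 1))| + 2 * pi +
    zint (fun z => e x z `^ p).
Proof.
have ha' := ha; have ha1' := ha1; have hr' := hr; have r2' := r2; have rpos' := rpos; have C0 := C_ge0.
move=> rx; have rx0 : r0 < x by lra.
have c2 := cep rx0.
have c1 : forall z : R, {for z, continuous (fun z => `|uz x z|)}.
  apply: (@cont2_slicez R r0 (fun r z => `|uz r z|)) => //.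
  by apply: cont2_comp (pf_cuz flow) => t; exact: norm_continuous.
have c0 : forall z : R, {for z, continuous (fun z : R => 1 : R)} by move=> z; exact: cst_continuous.
rewrite /speed -addrA lerD //.
  rewrite ler_wpM2l ?invr_ge0 ?mulr_ge0 ?pi_ge0 //.
  rewrite ler_pdivrMr ?r_gt0 // ler_peMr //; lra.
rewrite -[2 * pi]mulr1 -zint_cst -zintD //; apply: zint_le => // [z|z _].
  by apply: continuousD; [exact: c0|exact: c2].
have [h1|h1] := leP `|uz x z| 1.
  by apply: (le_trans h1); rewrite lerDl powR_ge0.
apply: (@le_trans _ _ (e x z `^ p)); last by rewrite lerDr.
apply: (@le_trans _ _ ((uz x z ^+ 2) `^ p)).
  rewrite -real_normK ?num_real //.
  apply: (@le_trans _ _ (`|uz x z| ^+ 2)).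
    by rewrite expr2 ler_peMr // ltW.
  by apply: le1r_powR => //; rewrite expr_ge1 // ltW.
by rewrite ge0_ler_powR ?nnegrE ?sqr_ge0 ?e_ge0 ?uz_e // ltW.
Qed.

Definition c_flux := 128 * expR c_speed * (c_mass * (4 * C + 4)).

Let inv2pi_le1 : (2 * pi)^-1 <= 1 :> R.
Proof. by rewrite invf_le1 ?mulr_gt0 ?pi_gt0 //; have := @pi_ge2 R; lra. Qed.

Let sum_le (f1 f2 n y X : R) : f1 <= 32 * X -> - f2 <= 64 * X -> n <= 16 * y -> y <= X ->
  0 <= X -> f1 + (- f2) + n <= 128 * X.
Proof. by move=> *; lra. Qed.

Let sup_le (i A D q W : R) : i * A <= A -> (1 + q) * (A + D) <= W -> 0 <= W -> 0 <= q * D ->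
  i * A + (q * A + D) <= 2 * W.
Proof. by move=> *; lra. Qed.

(** If the flux at a radius [s] were much larger than [kappa] in absolute value, then by
    monotonicity it would be so on a unit interval on one side of [s], where the
    velocity has bounded integral; by [growth_forward] or [growth_backward] the mass
    would be too large there. So the flux increment over [[r, 2 r]], which is the
    integral of [r] times the dissipation, is of order [kappa]. A mean value argument gives a
    radius where mass and dissipation are both of order [kappa * r ^- 2], and there
    [zint_sup] and [spow'_young] bound the supremum. *)
Lemma good_radius : exists xi, r <= xi <= 2 * r /\
  forall z, - pi <= z <= pi ->
    `|O xi z| `^ (2 * p) <= (1 + p) * (2 * c_flux) * (kappa * r ^- 2).
Proof.
have ha' := ha; have ha1' := ha1; have hr' := hr; have r2' := r2; have rpos' := rpos; have C0 := C_ge0.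
have pge := p_ge1.
have r0r : r0 < r by lra.
have l1 : r / 2 <= r by lra.
have l2 : r <= 2 * r by lra.
have l3 : 2 * r <= 4 * r by lra.
have k0 := scale_gt0; have cm := c_mass_ge0.
have [N dN] : exists N, forall x, r0 + 1 < x -> is_derive x (1:R) N (x ^+ 2 * mass O hh x).
  apply: primitive_exists => x rx; apply: continuousM.
    exact: exprn_continuous.
  exact: (mass_continuous flow dh dh1).
have [K dK] := primitive_exists (fun x rx => speed_continuous flow rx).
pose b := c_mass * (4 * C + 4).
have b0 : 0 <= b by rewrite mulr_ge0 //; lra.
(* [N] is a primitive of [x ^+ 2 * mass x], the quantity of [is_derive_r2mass] *)
have N_osc x y : r / 2 <= x -> x <= y -> y <= 4 * r -> N y - N x <= 16 * b * kappa * r.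
  move=> h1 h2 h3.
  have i1 t : x <= t <= y -> is_derive t (1:R) N (t ^+ 2 * mass O hh t).
    by move=> /andP[? ?]; apply: dN; lra.
  have i2 t : x <= t <= y -> is_derive t (1:R) (fun t => 16 * r ^+ 2 * (kappa * c_mass) * (E t + r ^- 2 * t))
      (16 * r ^+ 2 * (kappa * c_mass) * (zint (fun z => e t z `^ p) + r ^- 2 * 1)).
    move=> /andP[? ?]; have dEt : is_derive t (1:R) E (zint (fun z => e t z `^ p)) by apply: dE; lra.
    exact: (derZ _ (derD dEt (derZ _ (der_id t)))).
  have := derive_mono h2 i1 i2; move=> /(_ _)/le_trans; apply.
    move=> t /andP[? ?]; rewrite mulr1 -(mulrA (16 * r ^+ 2)).
    have ml := mass_le (_ : r / 2 <= t); have {}ml := ml ltac:(lra).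
    apply: (@le_trans _ _ (16 * r ^+ 2 * mass O hh t)); last first.
      by apply: ler_wpM2l => //; rewrite mulr_ge0 ?sqr_ge0.
    by rewrite ler_wpM2r ?mass_ge0 //; nra.
  rewrite -mulrBr.
  have Eo := E_osc h1 h2 h3.
  have q1 : E y + r ^- 2 * y - (E x + r ^- 2 * x) <= (4 * C + 4) / r.
    have : r ^- 2 * (y - x) <= 4 / r.
      rewrite mulrC ler_pdivrMr ?exprn_gt0 // expr2 mulrA divfK ?gt_eqF //; lra.
    by rewrite (mulrDl (4 * C)); lra.
  have q2 : 0 <= 16 * r ^+ 2 * (kappa * c_mass).
    by rewrite (mulr_ge0 (mulr_ge0 _ (sqr_ge0 r)) (mulr_ge0 (ltW k0) cm)).
  apply: (le_trans (ler_wpM2l q2 q1)).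
  rewrite /b le_eqVlt; apply/orP; left; apply/eqP; field; by rewrite gt_eqF.
(* over a unit interval the velocity has bounded integral *)
have K_osc x y : r / 2 <= x -> x <= y -> y <= 4 * r -> y - x <= 1 -> K y - K x <= c_speed.
  move=> h1 h2 h3 h4.
  pose c := (2 * pi)^-1 * `|(r0 + 1) * zint (u (r0 + 1))| + 2 * pi.
  have c0 : 0 <= c by rewrite /c addr_ge0 ?mulr_ge0 ?invr_ge0 ?mulr_ge0 ?pi_ge0.
  have i1 t : x <= t <= y -> is_derive t (1:R) K (speed r0 u uz t).
    by move=> /andP[? ?]; apply: dK; lra.
  have i2 t : x <= t <= y -> is_derive t (1:R) (fun t => c * t + E t) (c * 1 + zint (fun z => e t z `^ p)).
    move=> /andP[? ?]; have dEt : is_derive t (1:R) E (zint (fun z => e t z `^ p)) by apply: dE; lra.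
    exact: (derD (derZ _ (der_id t)) dEt).
  have := derive_mono h2 i1 i2; move=> /(_ _)/le_trans; apply.
    by move=> t /andP[? ?]; rewrite mulr1; apply: speed_le; lra.
  have Eo := E_osc h1 h2 h3.
  have : 4 * C / r <= 4 * C by rewrite ler_pdivrMr // ler_peMr //; lra.
  have : c * (y - x) <= c by rewrite ler_piMr.
  rewrite /c_speed -/c; lra.
pose F := flux u O Or hh hh1.
have Fm x y : r0 < x -> x <= y -> F x <= F y.
  by move=> rx xy; exact: (flux_mono flow dh dh1 ch2 h2_ge0).
have dP x : r0 < x -> is_derive x (1:R) (fun x => x ^+ 2 * mass O hh x)
    (x * F x + x ^+ 2 * drift u O hh x).
  by move=> rx; exact: (is_derive_r2mass flow dh dh1 rx).
have P_ge0 x : 0 <= x ^+ 2 * mass O hh x by rewrite mulr_ge0 ?sqr_ge0 ?mass_ge0.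
have drift_le' x : r0 + 1 <= x -> `|x ^+ 2 * drift u O hh x| <= speed r0 u uz x * (x ^+ 2 * mass O hh x).
  move=> rx; rewrite normrM ger0_norm ?sqr_ge0 // mulrCA ler_wpM2l ?sqr_ge0 //.
  by apply: (drift_le flow dh h_ge0) => [|y]; [lra|exact: (u_le_speed flow)].
have dF x : r0 < x -> is_derive x (1:R) F (x * dissipation O Or Oz hh2 x).
  by move=> rx; exact: (is_derive_flux flow dh dh1 ch2 rx).
have cfE : c_flux = 128 * expR c_speed * b by [].
have b_e : b <= expR c_speed * b.
  rewrite ler_peMl // -expR0 ler_expR /c_speed.
  by rewrite addr_ge0 ?addr_ge0 ?mulr_ge0 ?invr_ge0 ?mulr_ge0 ?pi_ge0.
clearbody F b.
have eC := expR_gt0 c_speed.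
pose X := expR c_speed * b * kappa.
have big : 0 <= X by exact: (mulr_ge0 (mulr_ge0 (ltW eC) b0) (ltW k0)).
have F_le s : r <= s -> s <= 2 * r -> F s <= 32 * X.
  move=> rs sr; have [Fs|Fs] := leP (F s) 0.
    by apply: (le_trans Fs); lra.
  have m0 : 0 <= s * F s by rewrite mulr_ge0 // ltW //; lra.
  have s1 : s <= s + 1 by lra.
  have j1 x : s <= x <= s + 1 -> is_derive x (1:R) (fun x => x ^+ 2 * mass O hh x)
    (x * F x + x ^+ 2 * drift u O hh x) by move=> /andP[? ?]; apply: dP; lra.
  have j2 x : s <= x <= s + 1 -> is_derive x (1:R) K (speed r0 u uz x).
    by move=> /andP[? ?]; apply: dK; lra.
  have j3 x : s <= x <= s + 1 -> is_derive x (1:R) N (x ^+ 2 * mass O hh x).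
    by move=> /andP[? ?]; apply: dN; lra.
  have j4 x : s <= x <= s + 1 -> 0 <= speed r0 u uz x.
    by move=> /andP[? ?]; apply: (speed_ge0 flow); lra.
  have j5 x : s <= x <= s + 1 -> s * F s - speed r0 u uz x * (x ^+ 2 * mass O hh x)
      <= x * F x + x ^+ 2 * drift u O hh x.
    move=> /andP[sx xs]; have rx1 : r0 + 1 <= x by lra.
    have := drift_le' x rx1; rewrite ler_norml => /andP[dl _].
    have s0 : 0 <= s by exact: le_trans (ltW rpos) rs.
    have Fsx : F s <= F x by apply: Fm => //; lra.
    exact: lerD (ler_pM s0 (ltW Fs) sx Fsx) dl.
  have := growth_forward s1 m0 j1 j2 j3 (fun x _ => P_ge0 x) j4 j5 (K_osc s (s + 1) _ _ _ _).
  have -> : (s + 1 - s) ^+ 2 = 1 by ring.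
  rewrite mulr1 => /(_ ltac:(lra) ltac:(lra) ltac:(lra) ltac:(lra)) G1.
  have G2 := N_osc s (s + 1) ltac:(lra) s1 ltac:(lra).
  have G3 : s * F s <= 2 * expR c_speed * (16 * b * kappa * r).
    by apply: (le_trans G1); rewrite ler_wpM2l // mulr_ge0 // ltW.
  rewrite -(ler_pM2l rpos); apply: le_trans (_ : s * F s <= _).
    by rewrite ler_wpM2r // ltW.
  by apply: (le_trans G3); rewrite /X le_eqVlt; apply/orP; left; apply/eqP; field.
have F_ge s : r <= s -> s <= 2 * r -> - F s <= 64 * X.
  move=> rs sr; have [Fs|Fs] := leP 0 (F s).
    apply: (@le_trans _ _ 0); first by rewrite oppr_le0.
    by lra.
  have m0 : 0 <= (s - 1) * (- F s) by rewrite mulr_ge0 //; lra.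
  have s1 : s - 1 <= s by lra.
  have j1 x : s - 1 <= x <= s -> is_derive x (1:R) (fun x => x ^+ 2 * mass O hh x)
    (x * F x + x ^+ 2 * drift u O hh x) by move=> /andP[? ?]; apply: dP; lra.
  have j2 x : s - 1 <= x <= s -> is_derive x (1:R) K (speed r0 u uz x).
    by move=> /andP[? ?]; apply: dK; lra.
  have j3 x : s - 1 <= x <= s -> is_derive x (1:R) N (x ^+ 2 * mass O hh x).
    by move=> /andP[? ?]; apply: dN; lra.
  have j4 x : s - 1 <= x <= s -> 0 <= speed r0 u uz x.
    by move=> /andP[? ?]; apply: (speed_ge0 flow); lra.
  have j5 x : s - 1 <= x <= s -> x * F x + x ^+ 2 * drift u O hh x <=
      - ((s - 1) * (- F s)) + speed r0 u uz x * (x ^+ 2 * mass O hh x).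
    move=> /andP[sx xs]; have rx1 : r0 + 1 <= x by lra.
    have := drift_le' x rx1; rewrite ler_norml => /andP[_ dl].
    have x0 : 0 <= x by lra.
    have rx : r0 < x by lra.
    have xF : x * F x <= x * F s by exact: ler_wpM2l x0 _ _ (Fm x s rx xs).
    have sF : x * F s <= (s - 1) * F s by rewrite ler_wnM2r // ltW.
    rewrite mulrN opprK; exact: lerD (le_trans xF sF) dl.
  have := growth_backward s1 m0 j1 j2 j3 (fun x _ => P_ge0 x) j4 j5 (K_osc (s - 1) s _ _ _ _).
  have -> : (s - (s - 1)) ^+ 2 = 1 by ring.
  rewrite mulr1 => /(_ ltac:(lra) ltac:(lra) ltac:(lra) ltac:(lra)) G1.
  have G2 := N_osc (s - 1) s ltac:(lra) s1 ltac:(lra).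
  have G3 : (s - 1) * (- F s) <= 2 * expR c_speed * (16 * b * kappa * r).
    by apply: (le_trans G1); rewrite ler_wpM2l // mulr_ge0 // ltW.
  have r2p : 0 < r / 2 by lra.
  rewrite -(ler_pM2l r2p); apply: le_trans (_ : (s - 1) * (- F s) <= _).
    by rewrite ler_wpM2r //; lra.
  by apply: (le_trans G3); rewrite /X le_eqVlt; apply/orP; left; apply/eqP; field.
have rr2 : r < 2 * r by lra.
(* this derivative is at least [r] times the sum of mass and dissipation *)
have dPhi x : r <= x <= 2 * r -> is_derive x (1:R) (fun x => F x + r^-1 * N x)
    (x * dissipation O Or Oz hh2 x + r^-1 * (x ^+ 2 * mass O hh x)).
  move=> /andP[? ?]; have k1 : r0 < x by lra.
  have k2 : r0 + 1 < x by lra.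
  exact: (derD (dF _ k1) (derZ _ (dN _ k2))).
have [xi /andP[xi1 xi2] Exi] := derive_mvt rr2 dPhi.
exists xi; split; first by rewrite xi1.
have Nr : r^-1 * (N (2 * r) - N r) <= 16 * b * kappa.
  by rewrite mulrC ler_pdivrMr //; exact: (N_osc _ _ l1 l2 l3).
have tot : F (2 * r) + r^-1 * N (2 * r) - (F r + r^-1 * N r) <= c_flux * kappa.
  have -> : F (2 * r) + r^-1 * N (2 * r) - (F r + r^-1 * N r) =
    F (2 * r) + (- F r) + r^-1 * (N (2 * r) - N r) by ring.
  have -> : c_flux * kappa = 128 * X by rewrite cfE /X; ring.
  apply: (@sum_le _ _ _ (b * kappa)) => //.
  - exact: F_le l2 (lexx _).
  - exact: F_ge (lexx _) l2.
  - by rewrite mulrA.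
  - by rewrite ler_wpM2r // ltW.
set D := dissipation O Or Oz hh2 xi in Exi *; set A := mass O hh xi in Exi *.
have D0 : 0 <= D by exact: dissipation_ge0.
have A0 : 0 <= A by exact: mass_ge0.
have AD : A + D <= c_flux * (kappa * r ^- 2).
  rewrite mulrA ler_pdivlMr ?exprn_gt0 //; apply: le_trans tot.
  rewrite Exi; have -> : 2 * r - r = r by ring.
  have -> : (xi * D + r^-1 * (xi ^+ 2 * A)) * r = xi * r * D + xi ^+ 2 * A.
    by field; rewrite gt_eqF.
  rewrite mulrC mulrDr addrC; apply: lerD.
    by rewrite ler_wpM2r // expr2 ler_wpM2r // ltW.
  by rewrite ler_wpM2r // ler_sqr ?nnegrE // ?(le_trans (ltW rpos) xi1) // ltW.
move=> z zpi.
have rx0 : r0 < xi by exact: lt_le_trans r0r xi1.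
apply: (le_trans (spow_ge d (O xi z) (ltW p_gt0))).
have dhz y : is_derive y (1:R) (fun z => hh (O xi z)) (hh1 (O xi y) * Oz xi y).
  exact: der_comp (dh _) (pf_Oz flow y rx0).
have cO : cont2 r0 (fun r z => hh (O r z)).
  by apply: cont2_comp (pf_cO flow) => t; exact: is_derive_cont (dh t).
have c2 : cont2 r0 (fun r z => hh2 (O r z)) by exact: cont2_comp (pf_cO flow).
have cg1 : cont2 r0 (fun r z => p * hh (O r z)) by exact: cont2M (@cont2_cst R r0 p) cO.
have cg2 : cont2 r0 (fun r z => hh2 (O r z) * (Or r z ^+ 2 + Oz r z ^+ 2)).
  exact: cont2M c2 (cont2D (cont2M (pf_cOr flow) (pf_cOr flow)) (cont2M (pf_cOz flow) (pf_cOz flow))).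
have := @zint_sup R (fun z => hh (O xi z)) (fun z => hh1 (O xi z) * Oz xi z)
  (fun z => p * hh (O xi z) + hh2 (O xi z) * (Or xi z ^+ 2 + Oz xi z ^+ 2)) dhz
  (cont2_slicez (cont2D cg1 cg2) rx0) _ z zpi.
rewrite (zintD (cont2_slicez cg1 rx0) (cont2_slicez cg2 rx0)).
rewrite (zintZ _ (cont2_slicez cO rx0)) -/A -/D -/(mass O hh xi) -/A (ger0_norm A0) => sup.
apply: (le_trans (ler_norm _)); apply: (le_trans (sup _)).
  move=> y _; apply: (le_trans (spow'_young _ _ d_gt0 p_ge1)).
  by rewrite lerD2l ler_wpM2l ?spow''_ge0 // lerDr sqr_ge0.
have t1 : (2 * pi)^-1 * A <= A by rewrite ler_piMl // inv2pi_le1.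
have t2 : (1 + p) * (A + D) <= (1 + p) * (c_flux * (kappa * r ^- 2)).
  by rewrite ler_wpM2l // addr_ge0 // ltW.
have t3 : 0 <= (1 + p) * (c_flux * (kappa * r ^- 2)).
  by apply: le_trans t2; rewrite mulr_ge0 ?addr_ge0 // ltW.
have t4 : 0 <= p * D by rewrite mulr_ge0 // ltW.
have -> : (1 + p) * (2 * c_flux) * (kappa * r ^- 2) = 2 * ((1 + p) * (c_flux * (kappa * r ^- 2))).
  by ring.
exact: sup_le t1 t2 t3 t4.
Qed.

End Annulus.

(** Every large [r] lies between a good radius in [[r / 2, r]] and one in [[r, 2 r]];
    the maximum principle carries the bound from these two to [r]. *)
Theorem planar_decay : exists C' b, [/\ 0 <= C', 0 < b & forall r z, b < r -> - pi <= z <= pi ->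
  (O r z ^+ 2) `^ p <= C' * ((r ^- 2) `^ p * r ^- 2)].
Proof.
have ha' := ha; have ha1' := ha1; have C0 := C_ge0; have pge := p_ge1.
pose c := (1 + p) * (2 * c_flux).
have c0 : 0 <= c.
  rewrite /c mulr_ge0 //; first lra.
  rewrite mulr_ge0 // /c_flux mulr_ge0 ?mulr_ge0 ?expR_ge0 // /c_mass.
    by rewrite addr_ge0 ?powR_ge0 // mulr_ge0 ?pi_ge0.
  by rewrite addr_ge0 // mulr_ge0.
exists (c * (4 `^ p * 4)), (2 * (2 * a + 2)); split.
- by rewrite mulr_ge0 // mulr_ge0 ?powR_ge0.
- lra.
move=> r z hr zpi.
have r2 : 2 * a + 2 < r / 2 by lra.
have r1 : 2 * a + 2 < r by lra.
have [x [/andP[x1 x2] Ox]] := good_radius r2.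
have [y [/andP[y1 y2] Oy]] := good_radius r1.
have r_pos : 0 < r by lra.
have V0 : 0 < r ^- 2 by rewrite invr_gt0 exprn_gt0.
set X := c * (4 `^ p * 4) * ((r ^- 2) `^ p * r ^- 2).
have X0 : 0 <= X.
  apply: mulr_ge0; first by rewrite mulr_ge0 // mulr_ge0 ?powR_ge0.
  by rewrite mulr_ge0 ?powR_ge0 // ltW.
have sqp (s : R) : `|s| `^ (2 * p) = (s ^+ 2) `^ p.
  by rewrite powRrM powR_mulrn // real_normK ?num_real.
have half : (r / 2) ^- 2 = 4 * r ^- 2 by field; rewrite gt_eqF.
have bx t : - pi <= t <= pi -> (O x t ^+ 2) `^ p <= X.
  move=> /Ox; rewrite sqp /scale half (@powRM _ 4 (r ^- 2)) ?(ltW V0) // -/c => h.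
  by apply: (le_trans h); rewrite le_eqVlt; apply/orP; left; apply/eqP; rewrite /X; ring.
have by_ t : - pi <= t <= pi -> (O y t ^+ 2) `^ p <= X.
  move=> /Oy; rewrite sqp /scale -/c => h; apply: (le_trans h).
  rewrite /X -(mulrA c); apply: ler_wpM2l => //.
  rewrite ler_peMl ?mulr_ge0 ?powR_ge0 // ?(ltW V0) //.
  have : 1 <= 4 `^ p :> R.
    have four : 1 <= 4 :> R by lra.
    by have := ler_powR four (ltW p_gt0); rewrite powRr0.
  lra.
have toK s : (s ^+ 2) `^ p <= X -> s ^+ 2 <= X `^ p^-1.
  move=> h; rewrite -[s ^+ 2]powRr1 ?sqr_ge0 // -(mulfV (lt0r_neq0 p_gt0)) powRrM.
  by rewrite ge0_ler_powR ?nnegrE ?powR_ge0 // invr_ge0 ltW.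
have := @vorticity_max_principle x y (X `^ p^-1) _ _ (fun t ht => toK _ (bx t ht))
  (fun t ht => toK _ (by_ t ht)) r z.
move=> /(_ ltac:(lra) ltac:(lra)) /(_ _ zpi) mp.
have {}mp := mp ltac:(apply/andP; split; lra).
rewrite -[X]powRr1 // -(mulVf (lt0r_neq0 p_gt0)) powRrM.
by rewrite ge0_ler_powR ?nnegrE ?powR_ge0 ?sqr_ge0 // ltW.
Qed.

End Decay.

(** * Restriction of smooth fields to the half-plane *)

Section Coordinates.
Context {R : realType}.
Implicit Types (f : 'rV[R]_3 -> R) (x y z : R).

Definition i0 : 'I_3 := @Ordinal 3 0 isT.
Definition i1 : 'I_3 := @Ordinal 3 1 isT.
Definition i2 : 'I_3 := @Ordinal 3 2 isT.

Lemma sum3 (F : 'I_3 -> R) : \sum_(j < 3) F j = F i0 + F i1 + F i2.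
Proof.
rewrite !big_ord_recl big_ord0 addr0 addrA; congr (_ + _ + _); congr F; exact/val_inj.
Qed.

Lemma vec3_0 x y z : vec3 x y z 0 i0 = x. Proof. by rewrite mxE. Qed.
Lemma vec3_1 x y z : vec3 x y z 0 i1 = y. Proof. by rewrite mxE. Qed.
Lemma vec3_2 x y z : vec3 x y z 0 i2 = z. Proof. by rewrite mxE. Qed.

Lemma vec3P (a b : 'rV[R]_3) : a 0 i0 = b 0 i0 -> a 0 i1 = b 0 i1 -> a 0 i2 = b 0 i2 -> a = b.
Proof.
move=> h0 h1 h2; apply/rowP => -[[|[|[|//]]] hi].
- by rewrite (_ : Ordinal hi = i0) //; exact/val_inj.
- by rewrite (_ : Ordinal hi = i1) //; exact/val_inj.
- by rewrite (_ : Ordinal hi = i2) //; exact/val_inj.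
Qed.

Lemma vec3E x y z : vec3 x y z = x *: ebasis i0 + y *: ebasis i1 + z *: ebasis i2.
Proof. by apply: vec3P; rewrite !mxE /= ?(mulr1, mulr0, addr0, add0r). Qed.

(** A directional derivative is the derivative along any parametrization of the line;
    this is how Cartesian partial derivatives become one-variable derivatives. *)
Lemma is_derive_line f (p v : 'rV[R]_3) (l : R -> 'rV[R]_3) (t : R) :
  (forall h, l (h + t) = h *: v + p) -> derivable f p v ->
  is_derive t (1:R) (fun s => f (l s)) ('D_v f p).
Proof.
move=> hl df.
have E : (fun h : R => h^-1 *: (f (l (h *: (1:R) + t)) - f (l t))) =
         (fun h : R => h^-1 *: (f (h *: v + p) - f p)).
  apply/funext => h; rewrite [h *: 1]mulr1 hl.
  by have := hl 0; rewrite add0r scale0r add0r => ->.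
by apply: DeriveDef; rewrite /derivable /derive E.
Qed.

Lemma is_derive_x f x y z : derivable f (vec3 x y z) (ebasis i0) ->
  is_derive x (1:R) (fun x => f (vec3 x y z)) (partial i0 f (vec3 x y z)).
Proof.
apply: (@is_derive_line f (vec3 x y z) (ebasis i0) (fun s => vec3 s y z)) => h.
by rewrite !vec3E scalerDl !addrA.
Qed.

Lemma is_derive_y f x y z : derivable f (vec3 x y z) (ebasis i1) ->
  is_derive y (1:R) (fun y => f (vec3 x y z)) (partial i1 f (vec3 x y z)).
Proof.
apply: (@is_derive_line f (vec3 x y z) (ebasis i1) (fun s => vec3 x s z)) => h.
by rewrite !vec3E scalerDl !addrA (addrC (x *: _)).
Qed.

Lemma is_derive_z f x y z : derivable f (vec3 x y z) (ebasis i2) ->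
  is_derive z (1:R) (fun z => f (vec3 x y z)) (partial i2 f (vec3 x y z)).
Proof.
apply: (@is_derive_line f (vec3 x y z) (ebasis i2) (fun s => vec3 x y s)) => h.
by rewrite !vec3E scalerDl addrCA.
Qed.

Lemma vec3_continuous (y : R) : continuous (fun t : R * R => vec3 t.1 y t.2).
Proof.
rewrite (_ : (fun t : R * R => vec3 t.1 y t.2) =
  (fun t : R * R => t.1 *: ebasis i0 + y *: ebasis i1 + t.2 *: ebasis i2)); last first.
  by apply/funext => s; rewrite vec3E.
move=> t; apply: cvgD; first apply: cvgD.
- by apply: cvgZr_tmp; exact: cvg_fst.
- exact: cvg_cst.
- by apply: cvgZr_tmp; exact: cvg_snd.
Qed.

Lemma x1_vec3 x y z : x1 (vec3 x y z) = x. Proof. exact: vec3_0. Qed.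
Lemma x2_vec3 x y z : x2 (vec3 x y z) = y. Proof. exact: vec3_1. Qed.

Lemma radius_vec3 x y z : Defs.radius (vec3 x y z) = Num.sqrt (x ^+ 2 + y ^+ 2).
Proof. by rewrite /Defs.radius x1_vec3 x2_vec3. Qed.

Lemma radius_planar r z : 0 <= r -> Defs.radius (vec3 r 0 z) = r.
Proof. by move=> r0; rewrite radius_vec3 expr0n addr0 sqrtr_sqr ger0_norm. Qed.

End Coordinates.

Section Smooth.
Context {R : realType} (r0 : R) (hr0 : 0 < r0).
Implicit Types (f : 'rV[R]_3 -> R).

Definition planar f (r z : R) := f (vec3 r 0 z).

Lemma exterior_planar r z : r0 < r -> exterior r0 (vec3 r 0 z).
Proof.
by move=> rr; rewrite /exterior /= radius_planar // ltW // (lt_trans hr0).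
Qed.

Lemma smooth_partial U f i : smooth_on U f -> smooth_on U (partial i f).
Proof.
move=> sf s x Ux; have := sf (rcons s i) x Ux.
by rewrite /partials foldr_rcons.
Qed.

Lemma smooth_derivable U f x i : smooth_on U f -> U x -> derivable f x (ebasis i).
Proof. by move=> sf Ux; have [_] := sf [::] x Ux; apply. Qed.

Lemma smooth_continuous U f x : smooth_on U f -> U x -> {for x, continuous f}.
Proof. by move=> sf Ux; have [] := sf [::] x Ux. Qed.

Lemma smooth_cont2 f : smooth_on (exterior r0) f -> cont2 r0 (planar f).
Proof.
move=> sf r z rr; apply: (@continuous_comp _ _ _ (fun t : R * R => vec3 t.1 0 t.2) f).
  exact: vec3_continuous.
exact: (smooth_continuous sf (exterior_planar z rr)).
Qed.

Lemma smooth_der_r f r z : smooth_on (exterior r0) f -> r0 < r ->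
  is_derive r (1:R) ((planar f)^~ z) (planar (partial i0 f) r z).
Proof.
by move=> sf rr; apply: is_derive_x; exact: (smooth_derivable sf (exterior_planar z rr)).
Qed.

Lemma smooth_der_z f r z : smooth_on (exterior r0) f -> r0 < r ->
  is_derive z (1:R) (planar f r) (planar (partial i2 f) r z).
Proof.
by move=> sf rr; apply: is_derive_z; exact: (smooth_derivable sf (exterior_planar z rr)).
Qed.

Lemma smooth_mixed f r z : smooth_on (exterior r0) f -> r0 < r ->
  planar (partial i2 (partial i0 f)) r z = planar (partial i0 (partial i2 f)) r z.
Proof.
move=> sf rr; have s0 := smooth_partial i0 sf; have s2 := smooth_partial i2 sf.
exact: (@mixed_partials R r0 (planar f) (planar (partial i0 f)) (planar (partial i2 f))
  (planar (partial i2 (partial i0 f))) (planar (partial i0 (partial i2 f)))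
  (fun r z rr => smooth_der_r z sf rr) (fun r z rr => smooth_der_z z sf rr)
  (fun r z rr => smooth_der_z z s0 rr) (fun r z rr => smooth_der_r z s2 rr)
  (smooth_cont2 (smooth_partial i2 s0)) (smooth_cont2 (smooth_partial i0 s2)) r z rr).
Qed.

Definition z_periodic f := forall x, exterior r0 x -> f (x + vec3 0 0 (2 * pi)) = f x.

Lemma exterior_open : open (exterior r0).
Proof.
have c : continuous (@Defs.radius R).
  move=> x; apply: (@continuous_comp _ _ _ (fun x : 'rV[R]_3 => x1 x ^+ 2 + x2 x ^+ 2) Num.sqrt).
    have h1 : {for x, continuous (fun y : 'rV[R]_3 => x1 y ^+ 2)}.
      apply: (@continuous_comp _ _ _ (fun y : 'rV[R]_3 => x1 y) (fun t : R => t ^+ 2)).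
        exact: coord_continuous.
      exact: exprn_continuous.
    have h2 : {for x, continuous (fun y : 'rV[R]_3 => x2 y ^+ 2)}.
      apply: (@continuous_comp _ _ _ (fun y : 'rV[R]_3 => x2 y) (fun t : R => t ^+ 2)).
        exact: coord_continuous.
      exact: exprn_continuous.
    exact: cvgD h1 h2.
  exact: sqrt_continuous.
rewrite (_ : exterior r0 = (@Defs.radius R) @^-1` [set t | r0 < t]) //.
by apply: open_comp; [move=> x _; exact: c|exact: open_gt].
Qed.

(** Difference quotients commute with translations. *)
Lemma periodic_partial f i : z_periodic f -> z_periodic (partial i f).
Proof.
move=> pf x Ux; rewrite /partial.
transitivity ('D_(ebasis i) (fun y => f (y + vec3 0 0 (2 * pi))) x).
  rewrite /derive (_ : (fun h : R => h^-1 *: ((f \o shift (x + vec3 0 0 (2 * pi))) (h *: ebasis i) - _)) =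
    (fun h : R => h^-1 *: (((fun y => f (y + vec3 0 0 (2 * pi))) \o shift x) (h *: ebasis i) -
      f (x + vec3 0 0 (2 * pi))))) //.
  by apply/funext => h; rewrite /= /shift addrA.
apply: near_eq_derive; near=> y; apply: pf; near: y.
exact: (open_nbhs_nbhs (conj exterior_open Ux)).
Unshelve. all: by end_near. Qed.

Lemma planar_periodic f r : z_periodic f -> r0 < r -> planar f r pi = planar f r (- pi).
Proof.
move=> pf rr; rewrite /planar -(pf _ (exterior_planar (- pi) rr)); congr f.
apply: vec3P; rewrite !mxE /= ?addr0 //; ring.
Qed.

End Smooth.

(** * Transverse derivatives of axisymmetric fields *)

Section Radial.
Context {R : realType}.
Implicit Types (G k : R -> R) (x y : R).

Definition rad x y : R := Num.sqrt (x ^+ 2 + y ^+ 2).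

Lemma rad_gt0 x y : 0 < x -> 0 < rad x y.
Proof. by move=> x0; rewrite sqrtr_gt0 ltr_pwDl ?exprn_gt0 ?sqr_ge0. Qed.

Lemma rad_ge x y : 0 <= x -> x <= rad x y.
Proof.
by move=> x0; rewrite -{1}[x]ger0_norm // -sqrtr_sqr ler_wsqrtr // lerDl sqr_ge0.
Qed.

Lemma rad_sqr x y : rad x y ^+ 2 = x ^+ 2 + y ^+ 2.
Proof. by rewrite sqr_sqrtr // addr_ge0 ?sqr_ge0. Qed.

Lemma rad0 x : 0 <= x -> rad x 0 = x.
Proof. by move=> x0; rewrite /rad expr0n addr0 sqrtr_sqr ger0_norm. Qed.

Lemma radC x y : rad x y = rad y x.
Proof. by rewrite /rad addrC. Qed.

Lemma is_derive_rad x y : 0 < x -> is_derive y (1:R) (rad x) (y / rad x y).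
Proof.
move=> x0; have b0 : 0 < x ^+ 2 + y ^+ 2 by rewrite ltr_pwDl ?exprn_gt0 ?sqr_ge0.
apply: (der_eq (@der_comp R Num.sqrt (fun y => x ^+ 2 + y ^+ 2) y _ _ (is_derive1_sqrt b0)
  (derD (der_cst (x ^+ 2) y) (derX2 (der_id y))))).
rewrite add0r mulr1 -/(rad x y) invfM mulrACA mulVf // mul1r mulrC //.
Qed.

(** The difference quotient at [0] is [k] itself. This gives derivatives on the
    half-plane [y = 0] of functions of the radius, whose first [y]-derivatives are of
    the form [y * k y]. *)
Lemma is_derive_mulid0 k : {for 0, continuous k} -> is_derive (0:R) (1:R) (fun y => y * k y) (k 0).
Proof.
move=> ck.
have lk : (fun h : R => h^-1 *: ((h *: (1:R) + 0) * k (h *: (1:R) + 0) - 0 * k 0)) @ 0^' --> k 0.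
  apply: (@cvg_trans _ (k @ (0:R)^')); last exact: cvg_within_filter ck.
  apply: near_eq_cvg; near=> h.
  have h0 : h != 0 by near: h; exact: nbhs_dnbhs_neq.
  by rewrite mul0r subr0 addr0 [h *: 1]mulr1 [_ *: _]mulKf.
by apply: DeriveDef; [apply/cvg_ex; exists (k 0)|exact/cvg_lim].
Unshelve. all: by end_near. Qed.

Lemma is_derive_radial G (dG : R -> R) x y : 0 < x -> is_derive (rad x y) (1:R) G (dG (rad x y)) ->
  is_derive y (1:R) (fun y => G (rad x y)) (y * (dG (rad x y) / rad x y)).
Proof.
move=> x0 h; apply: (der_eq (der_comp h (is_derive_rad y x0))); ring.
Qed.

Lemma radial_continuous k x : 0 < x -> {for x, continuous k} ->
  {for (0 : R), continuous (fun y => k (rad x y) / rad x y)}.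
Proof.
move=> x0 ck.
have cr : {for (0:R), continuous (rad x)} by exact: is_derive_cont (is_derive_rad 0 x0).
apply: continuousM.
  by apply: (@continuous_comp _ _ _ (rad x) k) => //; rewrite rad0 // ltW.
by apply: continuousV; [rewrite rad0 ?gt_eqF // ltW|].
Qed.

End Radial.

Section Axisymmetric.
Context {R : realType} (r0 : R) (hr0 : 0 < r0).
Context (v : 'rV[R]_3 -> 'rV[R]_3) (p : 'rV[R]_3 -> R).
Context (haxi : axisymmetric r0 v p) (hsw : no_swirl r0 v).

Local Notation V0 := (component v i0).
Local Notation V1 := (component v i1).
Local Notation V2 := (component v i2).

Lemma cyl_exists x y z : 0 < x -> exists th, vec3 x y z = cyl (rad x y) th z :> 'rV[R]_3.
Proof.
move=> x0; have r_gt0 := rad_gt0 y x0; have rsq := rad_sqr x y.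
have yr : -1 <= y / rad x y <= 1.
  rewrite -ler_norml normf_div (gtr0_norm r_gt0) ler_pdivrMr // mul1r.
  by rewrite radC -sqrtr_sqr ler_wsqrtr // lerDl sqr_ge0.
exists (asin (y / rad x y)); rewrite /cyl; congr vec3.
- rewrite cos_asin //.
  have -> : 1 - (y / rad x y) ^+ 2 = (x / rad x y) ^+ 2.
    by rewrite !expr_div_n rsq; field; rewrite -rsq expf_neq0 // gt_eqF.
  rewrite sqrtr_sqr ger0_norm; first by rewrite mulrC divfK // gt_eqF.
  by rewrite divr_ge0 // ltW.
- by rewrite asinK ?in_itv // mulrC divfK // gt_eqF.
Qed.

Lemma dot_vec3 (a : 'rV[R]_3) (b c d : R) : dot a (vec3 b c d) = a 0 i0 * b + a 0 i1 * c + a 0 i2 * d.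
Proof. by rewrite /dot sum3 vec3_0 vec3_1 vec3_2. Qed.

Lemma v_r_planar r z : 0 < r -> v_r v (vec3 r 0 z) = planar V0 r z.
Proof.
move=> r_gt0; rewrite /v_r /e_r dot_vec3 x1_vec3 x2_vec3 radius_planar ?ltW //.
by rewrite mul0r !mulr0 !addr0 divff ?gt_eqF // mulr1.
Qed.

Lemma v_z_planar r z : v_z v (vec3 r 0 z) = planar V2 r z.
Proof. by rewrite /v_z /e_z dot_vec3 !mulr0 !add0r mulr1. Qed.

Lemma cyl0 r z : cyl r 0 z = vec3 r 0 z :> 'rV[R]_3.
Proof. by rewrite /cyl cos0 sin0 mulr1 mulr0. Qed.

(** In the frame [e_r], [e_theta] the absence of swirl reads [V1 * x = V0 * y], and
    [V0 * x + V1 * y] is [rad x y] times the radial velocity. *)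
Lemma axisym_components x y z : 0 < x -> r0 < rad x y ->
  [/\ V0 (vec3 x y z) = planar V0 (rad x y) z * (x / rad x y),
      V1 (vec3 x y z) = planar V0 (rad x y) z * (y / rad x y) &
      V2 (vec3 x y z) = planar V2 (rad x y) z].
Proof.
move=> x0 rr; have rp := rad_gt0 y x0; have [hr _ hz _] := haxi.
have [th E] := cyl_exists y z x0.
have Er : v_r v (vec3 x y z) = planar V0 (rad x y) z.
  by rewrite E (hr _ _ 0 _ rr) cyl0 v_r_planar.
have Ez : v_z v (vec3 x y z) = planar V2 (rad x y) z.
  by rewrite E (hz _ _ 0 _ rr) cyl0 v_z_planar.
have Et : v_theta v (vec3 x y z) = 0 by apply: hsw; rewrite /exterior /= radius_vec3.
move: Er Et Ez; rewrite /v_r /v_theta /v_z /e_r /e_theta /e_z !dot_vec3 x1_vec3 x2_vec3 radius_vec3.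
rewrite -/(rad x y) !mulr0 !addr0 !add0r mulr1 => Er Et <-.
have rsq := rad_sqr x y.
have rn : rad x y != 0 by rewrite gt_eqF.
rewrite -Er /component; set a := v _ 0 i0 in Er Et *; set b := v _ 0 i1 in Er Et *.
set s := rad x y in rp rsq rn Er Et *.
have Et' : b * x = a * y.
  have : (a * (- y / s) + b * (x / s)) * s = 0 by rewrite Et mul0r.
  have -> : (a * (- y / s) + b * (x / s)) * s = b * x - a * y by field.
  by move/eqP; rewrite subr_eq0 => /eqP.
split=> //.
- apply/esym.
  have -> : (a * (x / s) + b * (y / s)) * (x / s) = (a * x ^+ 2 + (b * x) * y) / s ^+ 2 by field.
  by rewrite Et' rsq; field; rewrite -rsq expf_neq0.
- apply/esym.
  have -> : (a * (x / s) + b * (y / s)) * (y / s) = ((a * y) * x + b * y ^+ 2) / s ^+ 2 by field.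
  by rewrite -Et' rsq; field; rewrite -rsq expf_neq0.
Qed.

Context (sv : forall i : 'I_3, smooth_on (exterior r0) (component v i)).

Let r_gt0 r : r0 < r -> 0 < r. Proof. exact: lt_trans. Qed.

Let ext x y z : 0 < x -> r0 < rad x y -> exterior r0 (vec3 x y z).
Proof. by move=> x0 rr; rewrite /exterior /= radius_vec3. Qed.

Lemma planar_V1 r z : r0 < r -> planar V1 r z = 0.
Proof.
move=> rr; have rp := r_gt0 rr.
have rr' : r0 < rad r 0 by rewrite rad0 // ltW.
have [_ E _] := axisym_components z rp rr'.
by rewrite /planar E mul0r mulr0.
Qed.

Lemma planar_dV1 r z : r0 < r -> planar (partial i1 V1) r z = planar V0 r z / r.
Proof.
move=> rr; have rp := r_gt0 rr; have r_ge0 := ltW rp.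
have d1 : is_derive (0:R) (1:R) (fun y => V1 (vec3 r y z)) (partial i1 V1 (vec3 r 0 z)).
  by apply: is_derive_y; exact: (smooth_derivable (sv i1) (exterior_planar hr0 z rr)).
have E : (fun y => V1 (vec3 r y z)) = (fun y => y * (planar V0 (rad r y) z / rad r y)).
  apply/funext => y; have ge := rad_ge y r_ge0.
  have [_ -> _] := axisym_components z rp (lt_le_trans rr ge).
  by rewrite mulrCA.
have d2 := is_derive_mulid0 (@radial_continuous R (fun s => planar V0 s z) r rp
  (cont2_slicer (smooth_cont2 hr0 (sv i0)) rr)).
rewrite -E in d2; rewrite rad0 // in d2.
by rewrite /planar; case: d1 => _ <-; case: d2 => _ <-.
Qed.

(** By the chain rule the first transverse derivative is [y * (dG rho / rho)], to which
    [is_derive_mulid0] applies. *)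
Lemma radial_second (f : 'rV[R]_3 -> R) (G dG : R -> R) r z : r0 < r ->
  smooth_on (exterior r0) f ->
  (forall y, f (vec3 r y z) = G (rad r y)) ->
  (forall s, r0 < s -> is_derive s (1:R) G (dG s)) -> {for r, continuous dG} ->
  planar (partial i1 (partial i1 f)) r z = dG r / r.
Proof.
move=> rr sf fG dGG cdG; have rp := r_gt0 rr; have r_ge0 := ltW rp.
have d1 : is_derive (0:R) (1:R) (fun y => partial i1 f (vec3 r y z)) (partial i1 (partial i1 f) (vec3 r 0 z)).
  apply: is_derive_y; apply: (smooth_derivable (smooth_partial i1 sf)).
  exact: exterior_planar.
have E : (fun y => partial i1 f (vec3 r y z)) = (fun y => y * (dG (rad r y) / rad r y)).
  apply/funext => y; have ge := lt_le_trans rr (rad_ge y r_ge0).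
  have e1 : is_derive y (1:R) (fun y => f (vec3 r y z)) (partial i1 f (vec3 r y z)).
    by apply: is_derive_y; exact: (smooth_derivable sf (ext z rp ge)).
  have e2 := is_derive_radial rp (dGG _ ge).
  have Ef : (fun y => f (vec3 r y z)) = (fun y => G (rad r y)) by apply/funext.
  by rewrite -Ef in e2; case: e1 => _ <-; case: e2.
have d2 := is_derive_mulid0 (radial_continuous rp cdG).
rewrite -E in d2; rewrite rad0 // in d2.
by rewrite /planar; case: d1 => _ <-; case: d2 => _ <-.
Qed.

Lemma planar_ddV2 r z : r0 < r ->
  planar (partial i1 (partial i1 V2)) r z = planar (partial i0 V2) r z / r.
Proof.
move=> rr; have rp := r_gt0 rr.
apply: (@radial_second V2 (fun s => planar V2 s z) (fun s => planar (partial i0 V2) s z)) => //.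
- move=> y; have ge := lt_le_trans rr (rad_ge y (ltW rp)).
  by have [_ _ ->] := axisym_components z rp ge.
- move=> s rs; exact: (smooth_der_r hr0 z (sv i2) rs).
- exact: (cont2_slicer (smooth_cont2 hr0 (smooth_partial i0 (sv i2)))).
Qed.

Lemma planar_ddV0 r z : r0 < r ->
  planar (partial i1 (partial i1 V0)) r z = planar (partial i0 V0) r z / r - planar V0 r z / r ^+ 2.
Proof.
move=> rr; have rp := r_gt0 rr.
pose dG s := (planar (partial i0 V0) s z * s^-1 + planar V0 s z * (- 1 / s ^+ 2)) * r.
have dGG s : r0 < s -> is_derive s (1:R) (fun s => planar V0 s z * s^-1 * r) (dG s).
  move=> rs; have s0 := r_gt0 rs; have sn : s != 0 by rewrite gt_eqF.
  apply: (der_eq (derM (derM (smooth_der_r hr0 z (sv i0) rs) (derV sn (der_id s))) (der_cst r s))).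
  by rewrite mulr0 addr0.
transitivity (dG r / r); last by rewrite /dG; field; rewrite gt_eqF.
apply: (@radial_second V0 _ dG r z rr (sv i0) _ dGG).
- move=> y; have ge := lt_le_trans rr (rad_ge y (ltW rp)).
  by have [-> _ _] := axisym_components z rp ge; rewrite mulrA mulrAC.
- have c0 : {for r, continuous (fun s : R => s^-1)} by apply: continuousV; [rewrite gt_eqF|exact: cvg_id].
  have c2 : {for r, continuous (fun s : R => - 1 / s ^+ 2)}.
    apply: continuousM; first exact: cst_continuous.
    by apply: continuousV; [rewrite expf_neq0 // gt_eqF|exact: exprn_continuous].
  apply: continuousM; last exact: cst_continuous.
  apply: continuousD; apply: continuousM => //.
    exact: (cont2_slicer (smooth_cont2 hr0 (smooth_partial i0 (sv i0)))).
  exact: (cont2_slicer (smooth_cont2 hr0 (sv i0))).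
Qed.

End Axisymmetric.

(** * The vorticity equation *)

Section VorticityEquation.
Context {R : realType}.

Lemma der_unique (f : R -> R) x a b :
  is_derive x (1:R) f a -> is_derive x (1:R) f b -> a = b.
Proof. by move=> [_ <-] [_ <-]. Qed.

Lemma der_local (f g : R -> R) r0 r a b : r0 < r -> (forall s, r0 < s -> f s = g s) ->
  is_derive r (1:R) f a -> is_derive r (1:R) g b -> a = b.
Proof.
move=> rr fg df dg; apply: (der_unique (f := g)) dg.
apply: (@near_eq_is_derive _ R R f _ _ _ _ _ df).
by near=> s; apply: fg; near: s; exact: lt_nbhsr.
Unshelve. all: by end_near. Qed.

(** The momentum equation in direction [0] or [2] on the half-plane, where [Z] is the
    vanishing component [V1] and [G] the second transverse derivative. Here and in the
    next lemmas the algebra is carried out on plain real numbers. *)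
Lemma NS_planar_algebra (A B Y C D E F G G' H Z : R) : Z = 0 -> G = G' ->
  A * B + Z * Y + C * D + E = F + G + H -> A * B + C * D + E = F + G' + H.
Proof. by move=> -> ->; rewrite mul0r addr0. Qed.

(** The difference of the [z]-derivative of the radial and the [r]-derivative of the axial
    momentum equation; in [u20] and the like, the digits are the directions of
    differentiation, the rightmost being applied first. The pressure cancels by [p20 = p02],
    and incompressibility turns the stretching term into [- u / r] times the vorticity. *)
Lemma curl_algebra (r u ur uz w wr wz u20 u02 u22 p20 p02 w00 w02 w20 u200 u002 u222 w000 w022 w220 : R) :
  r != 0 ->
  uz * ur + u * u20 + (wz * uz + w * u22) + p20 =
    u200 + (u20 * r^-1 + ur * 0 - (uz * (r ^+ 2)^-1 + u * 0)) + u222 ->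
  ur * wr + u * w00 + (wr * wz + w * w02) + p02 =
    w000 + (w00 * r^-1 + wr * (- 1 / r ^+ 2)) + w022 ->
  p20 = p02 -> u20 = u02 -> w20 = w02 -> u200 = u002 -> w022 = w220 -> ur + u / r + wz = 0 ->
  u * (u02 - w00) + w * (u22 - w20) - u / r * (uz - wr) =
  (u002 - w000) + (u222 - w220) + (u02 - w00) / r - (uz - wr) / r ^+ 2.
Proof.
move=> rn E1 E2 M1 M2 M3 M4 M5 Ed; rewrite M1 M2 M4 in E1; rewrite -M3 M5 in E2.
have -> : u002 = uz * ur + u * u02 + (wz * uz + w * u22) + p02 - (u02 * r^-1 - uz * (r ^+ 2)^-1) - u222.
  by lra.
have -> : w220 = ur * wr + u * w00 + (wr * wz + w * w20) + p02 - w000 - (w00 * r^-1 + wr * (- 1 / r ^+ 2)).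
  by lra.
have -> : wz = - ur - u / r by lra.
by field.
Qed.

Lemma quotient_algebra_r (r o o' : R) : r != 0 ->
  o' * r^-1 + o * (- 1 / r ^+ 2) = o' * r^-1 - o * (r^-1 * r^-1).
Proof. by move=> rn; field. Qed.

Lemma quotient_algebra_z (o o' c : R) : o' * c + o * 0 = o' * c.
Proof. by rewrite mulr0 addr0. Qed.

Lemma quotient_algebra_rr (r o o' o'' : R) : r != 0 ->
  o'' * r^-1 + o' * (- 1 / r ^+ 2) -
    (o' * (r^-1 * r^-1) + o * (- 1 / r ^+ 2 * r^-1 + r^-1 * (- 1 / r ^+ 2))) =
  o'' * r^-1 - 2 * o' * (r^-1 * r^-1) + 2 * o * (r^-1 * r^-1 * r^-1).
Proof. by move=> rn; field. Qed.

Lemma vorticity_quotient_algebra (r u w o o_r o_z o_rr o_zz : R) : r != 0 ->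
  u * o_r + w * o_z - u / r * o = o_rr + o_zz + o_r / r - o / r ^+ 2 ->
  u * (o_r * r^-1 - o * (r^-1 * r^-1)) + w * (o_z * r^-1) =
  (o_rr * r^-1 - 2 * o_r * (r^-1 * r^-1) + 2 * o * (r^-1 * r^-1 * r^-1)) + o_zz * r^-1 +
    3 / r * (o_r * r^-1 - o * (r^-1 * r^-1)).
Proof.
move=> rn E.
have -> : o_zz = u * o_r + w * o_z - u / r * o - (o_rr + o_r / r - o / r ^+ 2) by lra.
by field.
Qed.

Context (r0 : R) (hr0 : 0 < r0) (v : 'rV[R]_3 -> 'rV[R]_3) (p : 'rV[R]_3 -> R).
Context (sv : forall i : 'I_3, smooth_on (exterior r0) (component v i)).
Context (sp : smooth_on (exterior r0) p).
Context (hNS : stationary_NS (exterior r0) v p) (hper : periodic_x3 r0 v).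
Context (haxi : axisymmetric r0 v p) (hsw : no_swirl r0 v).

Local Notation V0 := (component v i0).
Local Notation V2 := (component v i2).
Local Notation D0 := (partial i0).
Local Notation D2 := (partial i2).
Local Notation P := planar.

Let r_gt0 r : r0 < r -> 0 < r. Proof. exact: lt_trans. Qed.

Lemma NS_radial r z : r0 < r ->
  P V0 r z * P (D0 V0) r z + P V2 r z * P (D2 V0) r z + P (D0 p) r z =
  P (D0 (D0 V0)) r z + (P (D0 V0) r z / r - P V0 r z / r ^+ 2) + P (D2 (D2 V0)) r z.
Proof.
move=> rr; have [H _] := hNS (exterior_planar hr0 z rr).
have H0 := H i0; rewrite !sum3 in H0.
exact: NS_planar_algebra (planar_V1 hr0 haxi hsw z rr) (planar_ddV0 hr0 haxi hsw sv z rr) H0.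
Qed.

Lemma NS_axial r z : r0 < r ->
  P V0 r z * P (D0 V2) r z + P V2 r z * P (D2 V2) r z + P (D2 p) r z =
  P (D0 (D0 V2)) r z + P (D0 V2) r z / r + P (D2 (D2 V2)) r z.
Proof.
move=> rr; have [H _] := hNS (exterior_planar hr0 z rr).
have H2 := H i2; rewrite !sum3 in H2.
exact: NS_planar_algebra (planar_V1 hr0 haxi hsw z rr) (planar_ddV2 hr0 haxi hsw sv z rr) H2.
Qed.

Lemma NS_div r z : r0 < r -> P (D0 V0) r z + P V0 r z / r + P (D2 V2) r z = 0.
Proof.
move=> rr; have [_ H] := hNS (exterior_planar hr0 z rr); rewrite sum3 in H.
have sub (a b b' c : R) : b = b' -> a + b + c = 0 -> a + b' + c = 0 by move=> ->.
exact: sub (planar_dV1 hr0 haxi hsw sv z rr) H.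
Qed.

Let s0 f := @smooth_partial R (exterior r0) f i0.
Let s2 f := @smooth_partial R (exterior r0) f i2.
Let dr f r z (sf : smooth_on (exterior r0) f) (rr : r0 < r) := smooth_der_r hr0 z sf rr.
Let dz f r z (sf : smooth_on (exterior r0) f) (rr : r0 < r) := smooth_der_z hr0 z sf rr.
Let mixed f r z (sf : smooth_on (exterior r0) f) (rr : r0 < r) := smooth_mixed hr0 z sf rr.

Definition om r z := P (D2 V0) r z - P (D0 V2) r z.
Let om_r r z := P (D0 (D2 V0)) r z - P (D0 (D0 V2)) r z.
Let om_z r z := P (D2 (D2 V0)) r z - P (D2 (D0 V2)) r z.
Let om_rr r z := P (D0 (D0 (D2 V0))) r z - P (D0 (D0 (D0 V2))) r z.
Let om_zz r z := P (D2 (D2 (D2 V0))) r z - P (D2 (D2 (D0 V2))) r z.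

Lemma vorticity_equation r z : r0 < r ->
  P V0 r z * om_r r z + P V2 r z * om_z r z - P V0 r z / r * om r z =
  om_rr r z + om_zz r z + om_r r z / r - om r z / r ^+ 2.
Proof.
move=> rr; have sV0 := sv i0; have sV2 := sv i2.
have rn : r != 0 by rewrite gt_eqF // r_gt0.
have z1 : z - 1 < z by lra.
have E1 := der_local z1
  (fun y _ => NS_radial y rr)
  (derD (derD (derM (dz z sV0 rr) (dz z (s0 sV0) rr)) (derM (dz z sV2 rr) (dz z (s2 sV0) rr)))
     (dz z (s0 sp) rr))
  (derD (derD (dz z (s0 (s0 sV0)) rr)
     (derB (derM (dz z (s0 sV0) rr) (der_cst r^-1 z)) (derM (dz z sV0 rr) (der_cst (r ^- 2) z))))
     (dz z (s2 (s2 sV0)) rr)).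
have E2 := der_local rr (fun s rs => NS_axial z rs)
  (derD (derD (derM (dr z sV0 rr) (dr z (s0 sV2) rr)) (derM (dr z sV2 rr) (dr z (s2 sV2) rr)))
     (dr z (s2 sp) rr))
  (derD (derD (dr z (s0 (s0 sV2)) rr)
     (derM (dr z (s0 sV2) rr) (derV rn (der_id r))))
     (dr z (s2 (s2 sV2)) rr)).
have M1 := mixed z sp rr.
have M2 y := mixed y sV0 rr.
have M2r s (rs : r0 < s) : P (D2 (D0 V0)) s z = P (D0 (D2 V0)) s z := mixed z sV0 rs.
have M3 y : P (D2 (D0 V2)) r y = P (D0 (D2 V2)) r y := mixed y sV2 rr.
have M4 : P (D2 (D0 (D0 V0))) r z = P (D0 (D0 (D2 V0))) r z.
  exact: (etrans (mixed z (s0 sV0) rr)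
    (der_local rr M2r (dr z (s2 (s0 sV0)) rr) (dr z (s0 (s2 sV0)) rr))).
have M5 : P (D0 (D2 (D2 V2))) r z = P (D2 (D2 (D0 V2))) r z.
  exact: (etrans (esym (mixed z (s2 sV2) rr)) (esym (der_local z1 (fun y _ => M3 y)
    (dz z (s2 (s0 sV2)) rr) (dz z (s0 (s2 sV2)) rr)))).
exact: curl_algebra rn E1 E2 M1 (M2 z) (M3 z) M4 M5 (NS_div z rr).
Qed.

(** [om] divided by [r] and its derivatives, spelled out by the quotient rule. *)
Definition Om r z := om r z * r^-1.
Definition Om_r r z := om_r r z * r^-1 - om r z * (r^-1 * r^-1).
Definition Om_z r z := om_z r z * r^-1.
Definition Om_rr r z := om_rr r z * r^-1 - 2 * om_r r z * (r^-1 * r^-1) + 2 * om r z * (r^-1 * r^-1 * r^-1).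
Definition Om_zz r z := om_zz r z * r^-1.

Let d_om_r r z : r0 < r -> is_derive r (1:R) (om^~ z) (om_r r z).
Proof. by move=> rr; exact: (derB (dr z (s2 (sv i0)) rr) (dr z (s0 (sv i2)) rr)). Qed.

Let d_om_z r z : r0 < r -> is_derive z (1:R) (om r) (om_z r z).
Proof. by move=> rr; exact: (derB (dz z (s2 (sv i0)) rr) (dz z (s0 (sv i2)) rr)). Qed.

Let d_om_rr r z : r0 < r -> is_derive r (1:R) (om_r^~ z) (om_rr r z).
Proof. by move=> rr; exact: (derB (dr z (s0 (s2 (sv i0))) rr) (dr z (s0 (s0 (sv i2))) rr)). Qed.

Let d_om_zz r z : r0 < r -> is_derive z (1:R) (om_z r) (om_zz r z).
Proof. by move=> rr; exact: (derB (dz z (s2 (s2 (sv i0))) rr) (dz z (s2 (s0 (sv i2))) rr)). Qed.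

Lemma axisymmetric_planar_flow :
  planar_flow r0 (P V0) (P (D0 V0)) (P (D2 V0)) (P V2) (P (D2 V2)) Om Om_r Om_z Om_rr Om_zz.
Proof.
have sV0 := sv i0; have sV2 := sv i2.
have c f : smooth_on (exterior r0) f -> cont2 r0 (P f) := smooth_cont2 hr0 (f := f).
have ci : cont2 r0 (fun r _ => r^-1) := cont2_inv (ltW hr0).
have c_om : cont2 r0 om := cont2B (c _ (s2 sV0)) (c _ (s0 sV2)).
have c_om_r : cont2 r0 om_r := cont2B (c _ (s0 (s2 sV0))) (c _ (s0 (s0 sV2))).
have c_om_z : cont2 r0 om_z := cont2B (c _ (s2 (s2 sV0))) (c _ (s2 (s0 sV2))).
have c_om_rr : cont2 r0 om_rr := cont2B (c _ (s0 (s0 (s2 sV0)))) (c _ (s0 (s0 (s0 sV2)))).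
have c_om_zz : cont2 r0 om_zz := cont2B (c _ (s2 (s2 (s2 sV0)))) (c _ (s2 (s2 (s0 sV2)))).
have c2 : cont2 r0 (fun _ _ => 2) := @cont2_cst R r0 2.
have pv i : z_periodic r0 (component v i) by move=> x Ux; rewrite /component hper.
have pp f i := @periodic_partial R r0 f i.
have per_diff (a b a' b' c0 : R) : a = a' -> b = b' -> (a - b) * c0 = (a' - b') * c0.
  by move=> -> ->.
split.
- exact: ltW hr0.
- exact: (c _ sV0).
- exact: (c _ (s0 sV0)).
- exact: (c _ (s2 sV0)).
- exact: (c _ sV2).
- exact: (c _ (s2 sV2)).
- exact: cont2M c_om ci.
- exact: cont2B (cont2M c_om_r ci) (cont2M c_om (cont2M ci ci)).
- exact: cont2M c_om_z ci.
- exact: cont2D (cont2B (cont2M c_om_rr ci) (cont2M (cont2M c2 c_om_r) (cont2M ci ci)))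
    (cont2M (cont2M c2 c_om) (cont2M (cont2M ci ci) ci)).
- exact: cont2M c_om_zz ci.
- move=> r z rr; exact: (dr z sV0 rr).
- move=> r z rr; exact: (dz z sV0 rr).
- move=> r z rr; exact: (dz z sV2 rr).
- move=> r z rr; have rn : r != 0 by rewrite gt_eqF // r_gt0.
  exact: (der_eq (derM (d_om_r z rr) (derV rn (der_id r))) (quotient_algebra_r _ _ rn)).
- move=> r z rr; exact: (der_eq (derM (d_om_z z rr) (der_cst r^-1 z)) (quotient_algebra_z _ _ _)).
- move=> r z rr; have rn : r != 0 by rewrite gt_eqF // r_gt0.
  have dV := derV rn (der_id r).
  exact: (der_eq (derB (derM (d_om_rr z rr) dV) (derM (d_om_r z rr) (derM dV dV)))
    (quotient_algebra_rr _ _ _ rn)).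
- move=> r z rr; exact: (der_eq (derM (d_om_zz z rr) (der_cst r^-1 z)) (quotient_algebra_z _ _ _)).
- move=> r rr; exact: (planar_periodic hr0 (pv i2) rr).
- move=> r rr; rewrite /Om /om.
  exact: (per_diff _ _ _ _ _ (planar_periodic hr0 (pp _ i2 (pv i0)) rr)
    (planar_periodic hr0 (pp _ i0 (pv i2)) rr)).
- move=> r rr; rewrite /Om_z /om_z.
  exact: (per_diff _ _ _ _ _ (planar_periodic hr0 (pp _ i2 (pp _ i2 (pv i0))) rr)
    (planar_periodic hr0 (pp _ i2 (pp _ i0 (pv i2))) rr)).
- move=> r z rr; exact: (NS_div z rr).
- move=> r z rr; have rn : r != 0 by rewrite gt_eqF // r_gt0.
  exact: (vorticity_quotient_algebra rn (vorticity_equation z rr)).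
Qed.

End VorticityEquation.

(** * The energy in cylindrical coordinates *)

Section Minorant.
Import HBNNSimple.
Local Open Scope ereal_scope.

(** The integral of a nonnegative function is a supremum over the simple functions below
    it, so the integral of [|grad v| `^ q] dominates that of any function below it. This
    replaces [|grad v| `^ q] by an explicit integrand to which Tonelli's theorem applies. *)
Lemma le_integral_minorant d (T : measurableType d) (R : realType)
    (mu : {measure set T -> \bar R}) (D : set T) (f g : T -> \bar R) :
  (forall x, 0 <= f x) -> (forall x, D x -> 0 <= g x) -> (forall x, ~ D x -> f x = 0) ->
  (forall x, D x -> f x <= g x) ->
  \int[mu]_x f x <= \int[mu]_(x in D) g x.
Proof.
move=> f0 g0 fD fg; rewrite ge0_integralTE // ge0_integralE //.
apply: ereal_sup_le => _ [h hf <-]; exists h => // x.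
apply: (le_trans (hf x)); rewrite patchE; case: ifPn => [/set_mem/fg //|].
by move=> /negP xD; rewrite fD // => Dx; apply: xD; exact/mem_set.
Qed.

End Minorant.

Section Caratheodory.
Context {R : realType}.

(** Such a function is the pointwise limit of functions piecewise constant in the first
    variable, obtained by rounding it down to a multiple of [1 / n.+1]. *)
Lemma caratheodory_measurable (f : R -> R -> R) :
  (forall z s : R, {for s, continuous (f^~ z)}) -> (forall s, measurable_fun setT (f s)) ->
  measurable_fun setT (fun t : R * R => f t.1 t.2).
Proof.
move=> cf mf.
pose N n : R := n.+1%:R.
have N0 n : 0 < N n by rewrite ltr0n.
pose h n (t : R * R) := f ((Num.floor (t.1 * N n))%:~R / N n) t.2.
apply: (@measurable_fun_cvg _ _ _ setT h).
- move=> n _ B mB; rewrite setTI.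
  have -> : h n @^-1` B = \bigcup_(k : int) (`[k%:~R / N n, (k + 1)%:~R / N n[%classic `*`
      ((f (k%:~R / N n)) @^-1` B)).
    apply/seteqP; split=> [[s z] /= hB|[s z] [k _ [/=]]].
      exists (Num.floor (s * N n)) => //; split=> //=.
      by rewrite in_itv /= ler_pdivrMr // ltr_pdivlMr // floor_itv.
    rewrite in_itv /= ler_pdivrMr // ltr_pdivlMr // => /floor_def kE Bz.
    by rewrite /h /= kE.
  apply: countable_bigcupT_measurable => // k; apply: measurableX.
    exact: measurable_itv.
  by rewrite -[X in measurable X]setTI; exact: mf.
- move=> [s z] _ /=; rewrite /h /=.
  apply: (@cvg_comp _ _ _ (fun n => (Num.floor (s * N n))%:~R / N n) (f^~ z) _ (nbhs s)); last exact: cf.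
  apply/cvgrPdist_lt => e e0; near=> n.
  have eN : (N n)^-1 < e by near: n; exact: (near_infty_natSinv_lt (PosNum e0)).
  have /andP[] := floor_itv (s * N n); rewrite intrD1.
  rewrite -ler_pdivrMr // -ltr_pdivlMr // mulrDl mul1r => h1 h2.
  by rewrite ger0_norm ?subr_ge0 // ltrBlDl (lt_trans h2) // ltrD2l.
Unshelve. all: by end_near. Qed.

End Caratheodory.

Section Polar.
Context {R : realType}.
Local Notation mu := (@lebesgue_measure R).

Lemma rad_sqrt_of (s y : R) : 0 <= s -> y ^+ 2 <= s ^+ 2 -> rad (Num.sqrt (s ^+ 2 - y ^+ 2)) y = s.
Proof.
by move=> s0 ys; rewrite /rad sqr_sqrtr ?subr_ge0 // subrK sqrtr_sqr ger0_norm.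
Qed.

Lemma rad_mono (x x' y : R) : 0 <= x -> x <= x' -> rad x y <= rad x' y.
Proof.
by move=> x0 xx; rewrite ler_wsqrtr // lerD2r ler_sqr ?nnegrE // (le_trans x0).
Qed.

Lemma rad_continuous_l (y x : R) : {for x, continuous (fun x => rad x y)}.
Proof.
apply: (@continuous_comp _ _ _ (fun x : R => x ^+ 2 + y ^+ 2) Num.sqrt); last exact: sqrt_continuous.
by apply: continuousD; [exact: exprn_continuous|exact: cst_continuous].
Qed.

Lemma measurable_rad : measurable_fun setT (fun t : R * R => rad t.1 t.2).
Proof.
change (measurable_fun setT (@Num.sqrt R \o (fun t : R * R => t.1 ^+ 2 + t.2 ^+ 2))).
apply: measurableT_comp.
  exact: continuous_measurable_fun (@sqrt_continuous R).
by apply: measurable_funD; apply: measurable_funX; [exact: measurable_fst|exact: measurable_snd].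
Qed.

(** Along a horizontal line [d rho = x / rho dx <= dx]; the limits of integration are the
    abscissae at which the line meets the circles of radii [r] and [2 * r]. *)
Lemma radial_slice (Z Phi : R -> R) (r y : R) : 0 < r -> 0 <= y <= r / 2 ->
  (forall s, 0 <= Z s) -> (forall s : R, {for s, continuous Z}) ->
  (forall s, r <= s -> is_derive s (1:R) Phi (Z s)) ->
  ((Phi (2 * r) - Phi r)%:E <=
   \int[mu]_(x in `[Num.sqrt (r ^+ 2 - y ^+ 2), Num.sqrt ((2 * r) ^+ 2 - y ^+ 2)]) (Z (rad x y))%:E)%E.
Proof.
move=> r_gt0 /andP[y0 yr] Z0 cZ dPhi.
set X1 := Num.sqrt (r ^+ 2 - y ^+ 2); set X2 := Num.sqrt _.
have r2y : 0 < r ^+ 2 - y ^+ 2 by nra.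
have X1p : 0 < X1 by rewrite sqrtr_gt0.
have X12 : X1 < X2 by rewrite ltr_sqrt //; nra.
have cZr (x : R) : {for x, continuous (fun x => Z (rad x y))}.
  by apply: (@continuous_comp _ _ _ (fun x => rad x y) Z); [exact: rad_continuous_l|exact: cZ].
have [G dG] := @primitive_exists R (fun x => Z (rad x y)) (- 2) (fun x _ => cZr x).
have dG' x : X1 <= x <= X2 -> is_derive x (1:R) G (Z (rad x y)).
  by move=> /andP[x1 _]; apply: dG; lra.
have Er : rad X1 y = r by apply: rad_sqrt_of; [lra|nra].
have Er2 : rad X2 y = 2 * r by apply: rad_sqrt_of; [lra|nra].
rewrite (continuous_FTC2 (F := G)) //; last 3 first.
- by apply/continuous_in_subspaceT => x _; exact: cZr.
- split.
  + by move=> x; rewrite in_itv => /andP[/ltW h1 /ltW h2]; case: (dG' x) => //; apply/andP.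
  + by apply: cvg_at_right_filter; apply: is_derive_cont (dG' _ _); rewrite lexx ltW.
  + by apply: cvg_at_left_filter; apply: is_derive_cont (dG' _ _); rewrite lexx ltW.
- move=> x; rewrite in_itv => /andP[/ltW h1 /ltW h2]; rewrite derive1E.
  by case: (dG' x) => //; apply/andP.
rewrite -EFinB lee_fin -Er2 -[in X in _ - X]Er.
have dPr x : X1 <= x <= X2 -> is_derive x (1:R) (fun x => Phi (rad x y)) (Z (rad x y) * (x / rad x y)).
  move=> /andP[x1 x2]; have x0 : 0 < x by exact: lt_le_trans x1.
  have h : r <= rad x y by rewrite -Er; apply: rad_mono => //; exact: ltW.
  have d := dPhi _ h.
  have E1 : (fun x => rad x y) = rad y by apply/funext => t; rewrite radC.
  have [y00|y_neq0] := eqVneq y 0.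
    have E2 : {near x, (fun x : R => x) =1 (fun x => rad x y)}.
      near=> t; rewrite y00 rad0 //; apply: ltW; near: t; exact: lt_nbhsr.
    have dr : is_derive x (1:R) (fun x => rad x y) 1.
      by apply: (@near_eq_is_derive _ R R (fun x => x) _ _ _ _ _ (der_id x)).
    by apply: (der_eq (@der_comp R Phi (fun x => rad x y) x _ _ d dr)); rewrite y00 rad0 ?ltW // divff // gt_eqF.
  have yp : 0 < y by rewrite lt_neqAle eq_sym y_neq0.
  have dr := is_derive_rad x yp; rewrite -E1 in dr.
  by apply: (der_eq (@der_comp R Phi (fun x => rad x y) x _ _ d dr)); rewrite radC.
apply: (derive_mono (ltW X12) dPr dG') => x /andP[x1 x2].
have x0 : 0 < x by exact: lt_le_trans x1.
rewrite ler_piMr // ler_pdivrMr ?rad_gt0 // mul1r.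
exact: rad_ge (ltW x0).
Unshelve. all: by end_near. Qed.

(** The part of the annulus [r <= rho <= 2 r] swept by horizontal segments at heights
    [0 <= y <= r / 2]. Each height sees the whole range of radii, so the sector accounts
    for the factor [r] of the area element without polar coordinates, and on it
    [x ^+ 2 >= 3 / 4 * rho ^+ 2]. *)
Definition sector (r : R) : set (R * R) :=
  [set t | [/\ 0 <= t.2 <= r / 2, 0 <= t.1 & r <= rad t.1 t.2 <= 2 * r]].

Lemma measurable_sector r : measurable (sector r).
Proof.
have -> : sector r = (snd @^-1` `[0, r / 2]%classic `&` fst @^-1` `[0, +oo[%classic) `&`
    (fun t : R * R => rad t.1 t.2) @^-1` `[r, 2 * r]%classic.
  apply/seteqP; split=> [t [h1 h2 h3]|t [[h1 h2] h3]] /=.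
    by rewrite !in_itv /= h1 h2 h3.
  by move: h1 h2 h3; rewrite /= !in_itv /= andbT.
apply: measurableI; first apply: measurableI.
- by rewrite -[X in measurable X]setTI; apply: measurable_snd.
- by rewrite -[X in measurable X]setTI; apply: measurable_fst.
- by rewrite -[X in measurable X]setTI; apply: measurable_rad.
Qed.

Local Notation mR := (measurableTypeR R).

(** The Borel structures carried by [R] and by the domain of the Lebesgue measure have
    the same measurable sets but are indexed differently. *)
Lemma measurable_borel_id : measurable_fun [set: mR] (fun x : mR => x : R).
Proof. by move=> _ B mB; rewrite setTI. Qed.

Lemma measurable_borel_id3 : measurable_fun [set: mR * mR * mR]
  (fun t : mR * mR * mR => t : R * R * R).
Proof.
have -> : (fun t : mR * mR * mR => t : R * R * R) = (fun t => ((t.1.1 : R, t.1.2 : R), t.2 : R)).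
  by apply/funext => -[[x y] z].
have m1 : measurable_fun setT (fst : mR * mR * mR -> mR * mR) := measurable_fst.
apply: measurable_fun_pair; first apply: measurable_fun_pair.
- exact: (measurableT_comp measurable_borel_id (measurableT_comp measurable_fst m1)).
- exact: (measurableT_comp measurable_borel_id (measurableT_comp measurable_snd m1)).
- exact: (measurableT_comp measurable_borel_id measurable_snd).
Qed.

(** The Lebesgue measure of the plane, named so that it carries its own sigma-finite
    structure for Tonelli's theorem. *)
Definition area : set (mR * mR) -> \bar R := (mu \x mu)%E.

HB.instance Definition _ := Measure.on area.

Lemma area_sigma_finite : sigma_finite setT area.
Proof.
pose I (n : nat) : set mR := `[- n%:R, n%:R]%classic.
exists (fun n => I n `*` I n).
  apply/seteqP; split=> // -[x y] _.
  pose n := (Num.truncn (`|x| + `|y|)).+1.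
  have xyn : `|x| + `|y| < n%:R by exact: truncnS_gt.
  have x0 := normr_ge0 x; have y0 := normr_ge0 y.
  by exists n => //; split; rewrite /I /= in_itv /= -ler_norml; lra.
move=> n; have mI : measurable (I n) by exact: measurable_itv.
split; first exact: measurableX.
rewrite /area product_measure1E //.
have h : (mu (I n) < +oo)%E.
  by rewrite /I /= lebesgue_measure_itv /=; case: ifP => _; rewrite ltry.
by rewrite lte_mul_pinfty // ge0_fin_numE.
Qed.

HB.instance Definition _ := Measure_isSigmaFinite.Build _ _ _ area area_sigma_finite.

Definition sector_weight (k : R -> R -> R) (r : R) (t : R * R * R) : R :=
  \1_(sector r) t.1 * (\1_(`[- pi, pi]%classic) t.2 * k (rad t.1.1 t.1.2) t.2).

(** Tonelli's theorem, integrating in [z], then along horizontal segments by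
    [radial_slice], then over the heights, an interval of length [r / 2]. *)
Lemma polar_lower_bound (k : R -> R -> R) (Phi : R -> R) (r : R) : 0 < r ->
  (forall s z, 0 <= k s z) -> (forall b, cont2 b k) ->
  (forall s, r <= s -> is_derive s (1:R) Phi (zint (k s))) ->
  ((r / 2 * (Phi (2 * r) - Phi r))%:E <=
   \int[(mu \x mu) \x mu]_t (sector_weight k r t)%:E)%E.
Proof.
move=> r_gt0 k0 ck dPhi.
have ckz (s z : R) : {for z, continuous (k s)}.
  by apply: (cont2_slicez (ck (s - 1))); lra.
have cks (z s : R) : {for s, continuous (k^~ z)}.
  by apply: (cont2_slicer (ck (s - 1))); lra.
have cZ (s : R) : {for s, continuous (fun s => zint (k s))}.
  by apply: (zint_cont (ck (s - 1))); lra.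
have Z0 s : 0 <= zint (k s) by apply: zint_ge0.
have mk : measurable_fun setT (fun t : R * R => k t.1 t.2).
  by apply: caratheodory_measurable => // s; apply: continuous_measurable_fun => z; exact: ckz.
have mW : measurable_fun setT (fun t : R * R * R => (sector_weight k r t)%:E).
  apply/measurable_EFinP.
  have m1 : measurable_fun setT (\1_(sector r) \o fst : R * R * R -> R).
    by apply: measurableT_comp; [apply: measurable_indic; exact: measurable_sector|exact: measurable_fst].
  have m2 : measurable_fun setT (\1_(`[- pi, pi]%classic) \o snd : R * R * R -> R).
    by apply: measurableT_comp; [exact: measurable_indic|exact: measurable_snd].
  have m3 : measurable_fun setT (fun t : R * R * R => (rad t.1.1 t.1.2, t.2)).
    apply: measurable_fun_pair; last exact: measurable_snd.
    by apply: (measurableT_comp measurable_rad); exact: measurable_fst.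
  have m4 : measurable_fun setT ((fun t : R * R => k t.1 t.2) \o
    (fun t : R * R * R => (rad t.1.1 t.1.2, t.2))) by exact: measurableT_comp.
  exact: (measurable_funM m1 (measurable_funM m2 m4)).
have mW' : measurable_fun setT (fun t : mR * mR * mR => (sector_weight k r t)%:E).
  exact: (measurableT_comp mW measurable_borel_id3).
have W0 t : (0 <= (sector_weight k r t)%:E)%E.
  by rewrite lee_fin mulr_ge0 // mulr_ge0.
pose F := fubini_F mu (fun t : mR * mR * mR => (sector_weight k r t)%:E).
have mF : measurable_fun setT F by exact: measurable_fun_fubini_tonelli_F.
have F0 t : (0 <= F t)%E by apply: integral_ge0 => z _; exact: W0.
have -> : (\int[(mu \x mu) \x mu]_t (sector_weight k r t)%:E =
    \int[mu]_y fubini_G mu F y)%E.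
  have E1 : (\int[(mu \x mu) \x mu]_t (sector_weight k r t)%:E = \int[mu \x mu]_t F t)%E.
    exact: (@fubini_tonelli1 _ _ _ _ R area mu _ mW' W0).
  have E2 : (\int[mu \x mu]_t F t = \int[mu]_y fubini_G mu F y)%E.
    exact: fubini_tonelli2 _ mF F0.
  by rewrite E1 E2.
have FE t : sector r t -> F t = (zint (k (rad t.1 t.2)))%:E.
  move=> St; rewrite /F /fubini_F /zint /Rintegral fineK; last first.
    by apply: integrable_fin_num => //; exact: zintegrable.
  rewrite [RHS]integral_mkcond; apply: eq_integral => z _.
  rewrite patchE /sector_weight /= indicE mem_set // mul1r indicE.
  by case: (z \in _); rewrite ?mul1r ?mul0r.
have slice y : 0 <= y <= r / 2 -> ((Phi (2 * r) - Phi r)%:E <= fubini_G mu F y)%E.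
  move=> yr; apply: (le_trans (radial_slice r_gt0 yr Z0 cZ dPhi)).
  set I := `[_, _]%classic.
  rewrite integral_mkcond; apply: le_integral_minorant => // x.
  - by rewrite patchE; case: ifPn => // _; rewrite lee_fin.
  - by move=> nT; exfalso; apply: nT.
  move=> _; rewrite patchE; case: ifPn => [/set_mem|_]; last exact: F0.
  move: yr => /andP[y0 yr].
  rewrite /I /= in_itv /= => /andP[x1 x2]; rewrite FE //.
  have x0 : 0 <= x by apply: le_trans x1; exact: sqrtr_ge0.
  have rp := ltW r_gt0.
  split=> /=; [by rewrite y0 yr|by []|apply/andP; split].
    rewrite -{1}(@rad_sqrt_of r y) //; last nra.
    by apply: rad_mono => //; exact: sqrtr_ge0.
  have r2p : 0 <= 2 * r by lra.
  rewrite -(@rad_sqrt_of (2 * r) y) //; last nra.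
  exact: rad_mono.
have c0 : 0 <= Phi (2 * r) - Phi r.
  have rr : r <= 2 * r by lra.
  have dP s : r <= s <= 2 * r -> is_derive s (1:R) Phi (zint (k s)).
    by move=> /andP[rs _]; exact: dPhi.
  by have := derive_mono rr (fun s _ => der_cst 0 s) dP (fun s _ => Z0 s); rewrite subrr.
have h : (\int[mu]_y ((fun=> (Phi (2 * r) - Phi r)%R%:E) \_ `[0%R, (r / 2)%R]%classic) y <=
   \int[mu]_y fubini_G mu F y)%E.
  apply: le_integral_minorant => // y.
  - by rewrite patchE; case: ifPn => // _; rewrite lee_fin.
  - by move=> _; apply: integral_ge0 => x _; exact: F0.
  - by move=> nT; exfalso; apply: nT.
  - move=> _; rewrite patchE; case: ifPn => [/set_mem|_].
      by rewrite /= in_itv /=; exact: slice.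
    by apply: integral_ge0 => x _; exact: F0.
apply: le_trans h; rewrite -integral_mkcond integral_cst //=.
rewrite lebesgue_measure_itv /= lte_fin divr_gt0 // -EFinB subr0 -EFinM lee_fin.
by rewrite mulrC.
Qed.

End Polar.

(** * The energy bound *)

Section Energy.
Context {R : realType}.
Local Notation mu := (@lebesgue_measure R).

Lemma two_of_nine (a b c d e f g h i : R) :
  c ^+ 2 + g ^+ 2 <=
  a ^+ 2 + b ^+ 2 + c ^+ 2 + (d ^+ 2 + e ^+ 2 + f ^+ 2) + (g ^+ 2 + h ^+ 2 + i ^+ 2).
Proof.
have ha := sqr_ge0 a; have hb := sqr_ge0 b; have hd := sqr_ge0 d; have he := sqr_ge0 e.
have hf := sqr_ge0 f; have hh := sqr_ge0 h; have hi := sqr_ge0 i; lra.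
Qed.

Lemma sector_aspect (s x y r : R) : 0 < r -> 0 <= y -> y <= r / 2 -> r <= s ->
  s ^+ 2 = x ^+ 2 + y ^+ 2 -> 3 / 4 * s ^+ 2 <= x ^+ 2.
Proof.
move=> r_gt0 y0 yr rs E.
have h1 : y ^+ 2 <= (r / 2) ^+ 2 by rewrite ler_sqr ?nnegrE //; lra.
have h2 : r ^+ 2 <= s ^+ 2 by rewrite ler_sqr ?nnegrE //; lra.
lra.
Qed.

Context (r0 : R) (hr0 : 0 < r0) (v : 'rV[R]_3 -> 'rV[R]_3) (pr : 'rV[R]_3 -> R).
Context (haxi : axisymmetric r0 v pr) (hsw : no_swirl r0 v).
Context (sv : forall i : 'I_3, smooth_on (exterior r0) (component v i)).

Local Notation V0 := (component v i0).
Local Notation V2 := (component v i2).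

Definition grad2 r z := planar (partial i2 V0) r z ^+ 2 + planar (partial i0 V2) r z ^+ 2.

Lemma grad2_ge0 r z : 0 <= grad2 r z.
Proof. by rewrite addr_ge0 ?sqr_ge0. Qed.

Lemma grad2_cont2 : cont2 r0 grad2.
Proof.
have c0 := smooth_cont2 hr0 (smooth_partial i2 (sv i0)).
have c2 := smooth_cont2 hr0 (smooth_partial i0 (sv i2)).
exact: cont2D (cont2M c0 c0) (cont2M c2 c2).
Qed.

Lemma partial_z_V0 x y z : 0 < x -> r0 < rad x y ->
  partial i2 V0 (vec3 x y z) = planar (partial i2 V0) (rad x y) z * (x / rad x y).
Proof.
move=> x0 rr.
have ext : exterior r0 (vec3 x y z) by rewrite /exterior /= radius_vec3.
have d1 := is_derive_z (smooth_derivable (sv i0) ext).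
have d2 := derM (smooth_der_z hr0 z (sv i0) rr) (der_cst (x / rad x y) z).
have E : (fun z => V0 (vec3 x y z)) = (fun z => planar V0 (rad x y) z * (x / rad x y)).
  by apply/funext => t; have [-> _ _] := axisym_components haxi hsw t x0 rr.
rewrite E in d1; apply: (etrans (der_unique d1 d2)).
exact: quotient_algebra_z.
Qed.

Lemma partial_x_V2 x y z : 0 < x -> r0 < rad x y ->
  partial i0 V2 (vec3 x y z) = planar (partial i0 V2) (rad x y) z * (x / rad x y).
Proof.
move=> x0 rr.
have ext : exterior r0 (vec3 x y z) by rewrite /exterior /= radius_vec3.
have d1 := is_derive_x (smooth_derivable (sv i2) ext).
have dr : is_derive x (1:R) (fun x => rad x y) (x / rad x y).
  have rp := rad_gt0 y x0.
  have b0 : 0 < x ^+ 2 + y ^+ 2 by rewrite ltr_pwDl ?exprn_gt0 ?sqr_ge0.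
  apply: (der_eq (@der_comp R Num.sqrt (fun x => x ^+ 2 + y ^+ 2) x _ _ (is_derive1_sqrt b0)
    (derD (derX2 (der_id x)) (der_cst (y ^+ 2) x)))).
  rewrite addr0 mulr1 -/(rad x y) invfM mulrACA mulVf // mul1r mulrC //.
have d2 := @der_comp R (fun s => planar V2 s z) (fun x => rad x y) x _ _ (smooth_der_r hr0 z (sv i2) rr) dr.
apply: (der_unique _ d2).
apply: (@near_eq_is_derive _ R R (fun x => V2 (vec3 x y z)) _ _ _ _ _ d1).
near=> t.
have t0 : 0 < t by near: t; exact: lt_nbhsr.
have tr : r0 < rad t y.
  near: t; apply: (cvgr_gt (rad x y)) => //; exact: rad_continuous_l.
by have [_ _ ->] := axisym_components haxi hsw z t0 tr.
Unshelve. all: by end_near. Qed.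

(** The entries [d v_0 / d z] and [d v_2 / d x] of the gradient are those of the half-plane
    multiplied by [x / rho]. *)
Lemma grad_norm_ge x y z : 0 < x -> r0 < rad x y -> 3 / 4 * rad x y ^+ 2 <= x ^+ 2 ->
  3 / 4 * grad2 (rad x y) z <= grad_norm v (vec3 x y z) ^+ 2.
Proof.
move=> x0 rr xr; have rp := rad_gt0 y x0.
rewrite /grad_norm sqr_sqrtr; last by apply: sumr_ge0 => i _; apply: sumr_ge0 => j _; exact: sqr_ge0.
rewrite !sum3; apply: (le_trans _ (two_of_nine _ _ _ _ _ _ _ _ _)).
rewrite (partial_z_V0 z x0 rr) (partial_x_V2 z x0 rr) !exprMn -mulrDl mulrC.
apply: ler_wpM2l; first exact: grad2_ge0.
by rewrite exprVn ler_pdivlMr // exprn_gt0.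
Qed.

Context (q : R) (hq : 2 <= q).
Context (hint : (grad_integral r0 q v < +oo)%E).

Let p := q / 2.
Let p_gt0 : 0 < p. Proof. have h := hq; rewrite /p; lra. Qed.

(** Replacing the radius by its maximum with [r] extends the integrand continuously to
    all of the plane without changing it on [sector r]. *)
Definition clamped (r s z : R) : R := (3 / 4 * grad2 (Num.max s r) z) `^ p.

Lemma clamped_cont2 r : r0 < r -> forall b, cont2 b (clamped r).
Proof.
move=> rr b s z _.
have c1 := cont2_comp (powR_norm_continuous p_gt0) (cont2M (@cont2_cst R r0 (3 / 4)) grad2_cont2).
have sr : r0 < Num.max s r by rewrite lt_max rr orbT.
have c2 := c1 (Num.max s r) z sr.
have -> : (fun x : R * R => clamped r x.1 x.2) =
    (fun x : R * R => `|3 / 4 * grad2 x.1 x.2| `^ p) \o (fun x => (Num.max x.1 r, x.2)).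
  apply/funext => x /=; rewrite /clamped ger0_norm // mulr_ge0 ?grad2_ge0 //; lra.
apply: continuous_comp c2.
apply: (@cvg_pair _ _ _ _ (nbhs (Num.max s r)) (nbhs z)); last exact: cvg_snd.
have cm : {for (s, z), continuous (fun x : R * R => Num.max x.1 r)}.
  by apply: continuous_max; [exact: cvg_fst|exact: cst_continuous].
exact: cm.
Qed.

Lemma sector_weight_le r : r0 < r ->
  (\int[(mu \x mu) \x mu]_t (sector_weight (clamped r) r t)%:E <= grad_integral r0 q v)%E.
Proof.
move=> rr; have r_gt0 : 0 < r by exact: lt_trans rr.
apply: le_integral_minorant => t.
- by rewrite lee_fin mulr_ge0 // mulr_ge0 // powR_ge0.
- by move=> _; rewrite lee_fin powR_ge0.
- move=> nt; rewrite /sector_weight !indicE.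
  case: (boolP (t.1 \in sector r)) => [/set_mem [_ _ /andP[h _]]|_]; last by rewrite mul0r.
  case: (boolP (t.2 \in _)) => [/set_mem h2|_]; last by rewrite mul0r mulr0.
  by exfalso; apply: nt; split; [exact: lt_le_trans rr h|move: h2; rewrite /= in_itv].
move=> [_ hz]; rewrite lee_fin /sector_weight !indicE.
case: (boolP (t.1 \in sector r)) => [/set_mem [/andP[y0 yr] x0 /andP[h h2]]|_]; last first.
  by rewrite mul0r powR_ge0.
rewrite mul1r mem_set ?mul1r; last by rewrite /= in_itv.
have rsq := rad_sqr t.1.1 t.1.2.
have h' : r0 < rad t.1.1 t.1.2 by exact: lt_le_trans h.
have xr : 3 / 4 * rad t.1.1 t.1.2 ^+ 2 <= t.1.1 ^+ 2.
  exact: sector_aspect r_gt0 y0 yr h rsq.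
have xp : 0 < t.1.1.
  have s2 : 0 < rad t.1.1 t.1.2 ^+ 2 by rewrite exprn_gt0 // (lt_trans hr0 h').
  have x2 : 0 < t.1.1 ^+ 2 by lra.
  by rewrite lt_neqAle x0 andbT eq_sym -sqrf_eq0 gt_eqF.
rewrite /clamped (max_idPl h).
have -> : q = 2 * p by rewrite /p; field.
rewrite powRrM powR_mulrn ?sqrtr_ge0 // ge0_ler_powR ?nnegrE ?sqr_ge0 ?(ltW p_gt0) //.
  by rewrite mulr_ge0 ?grad2_ge0 //; lra.
exact: grad_norm_ge.
Qed.

(** The finite integral of [|grad v| `^ q] bounds the energy in each annulus; the weight [r]
    is the one produced by [polar_lower_bound]. *)
Lemma planar_energy_bound : exists C E, 
  (forall r, r0 + 1 < r -> is_derive r (1:R) E (zint (fun z => grad2 r z `^ p))) /\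
  (forall r, r0 + 1 < r -> r * (E (2 * r) - E r) <= C).
Proof.
have h0 := hr0.
have cG : cont2 r0 (fun r z => grad2 r z `^ p).
  have -> : (fun r z => grad2 r z `^ p) = (fun r z => `|grad2 r z| `^ p).
    by apply/funext => r; apply/funext => z; rewrite ger0_norm // grad2_ge0.
  exact: cont2_comp (powR_norm_continuous p_gt0) grad2_cont2.
have [E dE] := primitive_exists (zint_cont cG).
pose c : R := (3 / 4) `^ p.
have c0 : 0 < c by rewrite powR_gt0 //; lra.
exists (2 / c * fine (grad_integral r0 q v)), E; split=> // r hr.
have r_gt0 : 0 < r by lra.
have rr : r0 < r by lra.
have dPhi s : r <= s -> is_derive s (1:R) (fun s => c * E s) (zint (clamped r s)).
  move=> rs; have rs1 : r0 + 1 < s by lra.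
  have rs0 : r0 < s by lra.
  apply: (der_eq (derZ c (dE _ rs1))).
  rewrite -(zintZ _ (cont2_slicez cG rs0)); congr zint; apply/funext => z.
  by rewrite /clamped (max_idPl rs) powRM ?grad2_ge0 //; lra.
have lb := polar_lower_bound r_gt0 (fun s z => powR_ge0 _ _) (clamped_cont2 rr) dPhi.
have := le_trans lb (sector_weight_le rr).
have T0 : (0 <= grad_integral r0 q v)%E.
  by apply: integral_ge0 => t _; rewrite lee_fin powR_ge0.
have Tf : grad_integral r0 q v \is a fin_num by rewrite ge0_fin_numE.
rewrite -[X in (_ <= X)%E -> _]fineK // lee_fin => h.
rewrite mulrAC ler_pdivlMr //.
have -> : r * (E (2 * r) - E r) * c = 2 * (r / 2 * (c * E (2 * r) - c * E r)) by field.
by rewrite ler_pM2l.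
Qed.

End Energy.

(** * Decay in the stated weights *)

Section Assembly.
Context {R : realType}.

Lemma powR_cvgy0 (g : R) : 0 < g -> r `^ (- g) @[r --> +oo%R] --> (0 : R).
Proof.
move=> g0; apply/cvgrPdist_lt => e e0; near=> r.
have r_gt0 : 0 < r by near: r; exact: nbhs_pinfty_gt.
rewrite sub0r normrN ger0_norm ?powR_ge0 // powRN.
have hr : e^-1 `^ g^-1 < r by near: r; apply: nbhs_pinfty_gt; exact: num_real.
have h : e^-1 < r `^ g.
  have -> : e^-1 = (e^-1 `^ g^-1) `^ g.
    by rewrite -powRrM mulVf ?gt_eqF // powRr1 // invr_ge0 ltW.
  by apply: gt0_ltr_powR; rewrite ?nnegrE ?powR_ge0 // ltW.
by rewrite -[e]invrK ltf_pV2 // posrE ?invr_gt0 // powR_gt0.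
Unshelve. all: by end_near. Qed.

Lemma weighted_decay_of_bound (f : R -> R -> R) (al be K b : R) : al < be ->
  (forall r z, b < r -> - pi <= z <= pi -> `|f r z| <= K * r `^ (- be)) ->
  weighted_decay al f.
Proof.
move=> ab hf; rewrite /weighted_decay.
have lim : ((K * r `^ (- (be - al)))%:E @[r --> +oo%R] --> (K * 0)%:E)%classic.
  apply: cvg_EFin; first by near=> r.
  apply: cvgM; first exact: cvg_cst.
  by apply: powR_cvgy0; rewrite subr_gt0.
rewrite mulr0 in lim; apply: squeeze_cvge (cvg_cst _) lim.
near=> r.
have rb : b < r by near: r; apply: nbhs_pinfty_gt; exact: num_real.
have r_gt0 : 0 < r by near: r; exact: nbhs_pinfty_gt.
have pp := @pi_gt0 R.
have z0 : - pi <= (0 : R) <= pi by rewrite oppr_le0 !ltW.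
have s0 : (0 <= sup_z f r)%E.
  apply: (@le_trans _ _ (`|f r 0|)%:E); first by rewrite lee_fin.
  by apply: ereal_sup_ubound; exists 0 => //=; rewrite in_itv.
apply/andP; split; first by rewrite mule_ge0 // lee_fin powR_ge0.
have s1 : (sup_z f r <= (K * r `^ (- be))%:E)%E.
  apply: ge_ereal_sup => _ [z hz <-]; rewrite lee_fin; apply: hf => //.
have -> : K * r `^ (- (be - al)) = r `^ al * (K * r `^ (- be)).
  rewrite mulrCA -powRD; last by rewrite (gt_eqF r_gt0) implybT.
  by congr (K * powR r _); ring.
by rewrite EFinM lee_wpmul2l // lee_fin powR_ge0.
Unshelve. all: by end_near. Qed.

Lemma omega_theta_planar (r0 : R) (v : 'rV[R]_3 -> 'rV[R]_3) r z : 0 < r0 ->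
  (forall i : 'I_3, smooth_on (exterior r0) (component v i)) -> r0 < r ->
  omega_theta v r z = om v r z.
Proof.
move=> hr0 sv rr; have r_gt0 : 0 < r by exact: lt_trans rr.
rewrite /omega_theta.
have -> : (fun z' => v_r v (cyl r 0 z')) = planar (component v i0) r.
  by apply/funext => t; rewrite cyl0 v_r_planar.
have -> : (fun r' => v_z v (cyl r' 0 z)) = (planar (component v i2))^~ z.
  by apply/funext => t; rewrite cyl0 v_z_planar.
have [_ d0] := smooth_der_z hr0 z (sv i0) rr.
have [_ d2] := smooth_der_r hr0 z (sv i2) rr.
by rewrite !derive1E; apply: (congr2 (fun a b => a - b) d0 d2).
Qed.

End Assembly.

Theorem theorem1p1 (R : realType) (r0 q : R)
    (v : 'rV[R]_3 -> 'rV[R]_3) (p : 'rV[R]_3 -> R)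
    (hr0 : 0 < r0) (hq : 2 <= q)
    (v_smooth : forall i : 'I_3, smooth_on (exterior r0) (component v i))
    (p_smooth : smooth_on (exterior r0) p)
    (hNS : stationary_NS (exterior r0) v p)
    (hper : periodic_x3 r0 v)
    (haxi : axisymmetric r0 v p)
    (hswirl : no_swirl r0 v)
    (hint : (grad_integral r0 q v < +oo)%E) :
  (2 < q -> weighted_decay (1 + 2 / q - 1 / q ^+ 2) (Omega v)) /\
  (q = 2 -> weighted_decay (3 / 2) (Omega v)) /\
  (2 < q -> weighted_decay (2 / q - 1 / q ^+ 2) (omega_theta v)) /\
  (q = 2 -> weighted_decay (1 / 2) (omega_theta v)).
Proof.
have flow := axisymmetric_planar_flow hr0 v_smooth p_smooth hNS hper haxi hswirl.
have [C [E [dE hE]]] := planar_energy_bound hr0 haxi hswirl v_smooth hq hint.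
have p_ge1 : 1 <= q / 2 by lra.
have q_gt0 : 0 < q by lra.
have Om_e r z : r0 < r -> (r * Om v r z) ^+ 2 <= 2 * grad2 v r z.
  move=> rr; have rn : r != 0 by rewrite gt_eqF // (lt_trans hr0).
  rewrite /Om mulrC divfK // /om /grad2.
  move: (planar _ r z) (planar _ r z) => a b; have := sqr_ge0 (a + b); lra.
have uz_e r z : r0 < r -> planar (partial i2 (component v i0)) r z ^+ 2 <= grad2 v r z.
  by move=> _; rewrite lerDl sqr_ge0.
have a1 : 1 <= r0 + 1 by lra.
have [C' [b [C'0 b0 dec]]] := planar_decay flow p_ge1 (grad2_cont2 hr0 v_smooth) uz_e Om_e
  (lexx _) a1 dE hE.
pose K := C' `^ q^-1.
have decO r z : b < r -> - pi <= z <= pi -> `|Om v r z| <= K * r `^ (- (1 + 2 / q)).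
  move=> br zpi; have r_gt0 : 0 < r by exact: lt_trans br.
  have h := dec r z br zpi.
  have V0 : 0 <= r ^- 2 by rewrite invr_ge0 exprn_ge0 // ltW.
  have E2 : r ^- 2 = r `^ (- 2) by rewrite powR_invn // ltW.
  have -> : `|Om v r z| = ((Om v r z ^+ 2) `^ (q / 2)) `^ q^-1.
    rewrite -real_normK ?num_real // -powR_mulrn // -!powRrM.
    rewrite [X in _ `^ X](_ : _ = 1) ?powRr1 //.
    by field; rewrite gt_eqF.
  apply: (@le_trans _ _ ((C' * ((r ^- 2) `^ (q / 2) * r ^- 2)) `^ q^-1)).
    by rewrite ge0_ler_powR ?nnegrE ?powR_ge0 ?mulr_ge0 ?powR_ge0 // invr_ge0 ltW.
  rewrite powRM ?mulr_ge0 ?powR_ge0 // -/K ler_wpM2l ?powR_ge0 //.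
  rewrite powRM ?powR_ge0 // E2 -!powRrM -powRD; last by rewrite (gt_eqF r_gt0) implybT.
  rewrite le_eqVlt; apply/orP; left; apply/eqP; congr powR.
  by field; rewrite gt_eqF.
pose b' := Num.max b r0.
have OmegaE r z : b' < r -> Omega v r z = Om v r z.
  rewrite gt_max => /andP[_ rr].
  by rewrite /Omega (omega_theta_planar _ hr0 v_smooth rr).
have bO r z : b' < r -> - pi <= z <= pi -> `|Omega v r z| <= K * r `^ (- (1 + 2 / q)).
  move=> br zpi; rewrite OmegaE //; apply: decO => //.
  by move: br; rewrite gt_max => /andP[].
have bo r z : b' < r -> - pi <= z <= pi -> `|omega_theta v r z| <= K * r `^ (- (2 / q)).
  move=> br zpi; have := bO r z br zpi.
  have r_gt0 : 0 < r by move: br; rewrite gt_max => /andP[+ _]; exact: lt_trans.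
  rewrite /Omega normf_div (gtr0_norm r_gt0) ler_pdivrMr // => /le_trans; apply.
  rewrite -mulrA ler_wpM2l ?powR_ge0 // -{2}(powRr1 (ltW r_gt0)) -powRD.
    by rewrite le_eqVlt; apply/orP; left; apply/eqP; congr powR; ring.
  by rewrite (gt_eqF r_gt0) implybT.
have qi : 0 < 1 / q ^+ 2 by rewrite divr_gt0 // exprn_gt0.
split; [|split; [|split]].
- by move=> _; apply: weighted_decay_of_bound bO; lra.
- by move=> q2; apply: weighted_decay_of_bound bO; rewrite q2; lra.
- by move=> _; apply: weighted_decay_of_bound bo; lra.
- by move=> q2; apply: weighted_decay_of_bound bo; rewrite q2; lra.
Qed.
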